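(* An operator $D$ on $\mathcal{H}$ gives rise to an equivariant (odd) spectral triple $(\mathcal{A},\mathcal{H},D)$ if and only if it is of the form $D: e^{(n)}_{ij}\mapsto d(n,i)e^{(n)}_{ij}$, where the numbers $d(n,i)$ ($n\in\{0,\frac12,1,\ldots\}$, $i\in\{-n,-n+1,\ldots,n\}$) are real and satisfy the following three conditions: (1) $d(n+\frac12,i+\frac12)-d(n,i)=O(1)$; (2) $d(n+\frac12,i-\frac12)-d(n,i)=O(n+i+1)$; (3) given any nonnegative real $N$, there exist positive integers $k$ and $l$ such that each of the sets $T(k), S(l,0), S(l,1),\ldots,S(l,k)$ is contained in either $\{x\in\mathbb{R}: x>N\}$ or $\{x\in\mathbb{R}: x<-N\}$, where $$T(k)=\left\{d\left(\tfrac{b+a}{2},\tfrac{b-a}{2}\right): a>k,\ b\geq 0\right\},\qquad S(l,r)=\left\{d\left(\tfrac{b+r}{2},\tfrac{b-r}{2}\right): b>l\right\}\quad (0\le r\le k),$$ with $a,b$ ranging over nonnegative integers.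
   Context: Fix a real number $q\in(0,1)$. $\mathcal{A}=C(SU_q(2))$ is the $C^*$-algebra generated by $\alpha,\beta$ subject to $\alpha^*\alpha+\beta^*\beta=I$, $\alpha\alpha^*+q^2\beta\beta^*=I$, $\alpha\beta-q\beta\alpha=0$, $\alpha\beta^*-q\beta^*\alpha=0$, $\beta^*\beta=\beta\beta^*$; $\mathcal{A}_f$ is the dense $*$-subalgebra generated by $\alpha,\beta$. $\mathcal{H}=L_2(h)$ is the GNS space of the (faithful) Haar state $h$ of $\mathcal{A}$. It has an orthonormal basis $\{e^{(n)}_{ij}: n=0,\frac12,1,\ldots;\ i,j=-n,-n+1,\ldots,n\}$ (normalized matrix entries of the irreducible representations), and $\mathcal{A}$ acts faithfully on $\mathcal{H}$ by $$\alpha e^{(n)}_{ij}=a_+(n,i,j)e^{(n+1/2)}_{i-1/2,j-1/2}+a_-(n,i,j)e^{(n-1/2)}_{i-1/2,j-1/2},\quad \beta e^{(n)}_{ij}=b_+(n,i,j)e^{(n+1/2)}_{i+1/2,j-1/2}+b_-(n,i,j)e^{(n-1/2)}_{i+1/2,j-1/2},$$ $$a_+=\Bigl(q^{2(n+i)+2(n+j)+2}\tfrac{(1-q^{2n-2j+2})(1-q^{2n-2i+2})}{(1-q^{4n+2})(1-q^{4n+4})}\Bigr)^{1/2},\quad a_-=\Bigl(\tfrac{(1-q^{2n+2j})(1-q^{2n+2i})}{(1-q^{4n})(1-q^{4n+2})}\Bigr)^{1/2},$$ $$b_+=-\Bigl(q^{2(n+j)}\tfrac{(1-q^{2n-2j+2})(1-q^{2n+2i+2})}{(1-q^{4n+2})(1-q^{4n+4})}\Bigr)^{1/2},\quad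 b_-=\Bigl(q^{2(n+i)}\tfrac{(1-q^{2n+2j})(1-q^{2n-2i})}{(1-q^{4n})(1-q^{4n+2})}\Bigr)^{1/2},$$ where terms involving basis vectors with indices out of range are zero. Odd spectral triple: $(\mathcal{A},\mathcal{H},D)$ is an odd spectral triple if $D$ is self-adjoint on $\mathcal{H}$, has compact resolvent, and $[D,a]$ is bounded for all $a\in\mathcal{A}_f$. Equivariance: let $A_0 e^{(n)}_{ij}=q^je^{(n)}_{ij}$, and $A_1e^{(n)}_{ij}=(q^{-2n}+q^{2n+2}-q^{-2j}-q^{2j+2})^{1/2}e^{(n)}_{i,j+1}$ if $j<n$, $A_1e^{(n)}_{in}=0$. An operator is equivariant if it commutes with $A_0,A_1,A_1^*$. Standing convention: the equivariant self-adjoint operators with discrete spectrum under consideration are those of the form $e^{(n)}_{ij}\mapsto d(n,i)e^{(n)}_{ij}$ with $d(n,i)$ real (the self-adjoint diagonal operator with these eigenvalues). The spectral triple is equivariant if $D$ is equivariant in this sense. The $O(\cdot)$ bounds are uniform over all admissible $(n,i)$. *)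

(* Defs.v *)
From HB Require Import structures.
From mathcomp Require Import all_boot all_order all_algebra.
From mathcomp Require Import complex.
From mathcomp Require Import all_classical all_reals all_analysis.
Set Implicit Arguments.
Unset Strict Implicit.
Unset Printing Implicit Defensive.
Import Order.TTheory GRing.Theory Num.Theory.
Import numFieldNormedType.Exports.
Local Open Scope classical_set_scope.
Local Open Scope ring_scope.
Local Open Scope complex_scope.

(** Possibly unbounded operators on a complex Hilbert space, as graphs:
    [D (x, y)] means that x is in the domain of D and D x = y.  The inner
    product is linear in its first argument. *)
Section UnboundedOperators.
Variables (R : realType) (H : completeNormedModType R[i]).
Variable dot : {dot H for Num.conj}.

Definition hilbert_norm : Prop := forall x : H, `|x| ^+ 2 = dot x x.

Definition is_operator (D : set (H * H)) : Prop :=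
  [/\ D (0, 0),
      forall (c : R[i]) x y x' y', D (x, y) -> D (x', y') ->
        D (c *: x + x', c *: y + y')
    & forall x y y', D (x, y) -> D (x, y') -> y = y'].

Definition domain (D : set (H * H)) : set H :=
  [set x | exists y, D (x, y)].

(* (y, z) is in the adjoint iff <D x, y> = <x, z> for all x in the domain *)
Definition adjoint (D : set (H * H)) : set (H * H) :=
  [set p | forall x w, D (x, w) -> dot w p.1 = dot x p.2].

Definition self_adjoint (D : set (H * H)) : Prop :=
  dense (domain D) /\ D = adjoint D.

Definition compact_operator (K : {linear H -> H}) : Prop :=
  precompact (K @` [set x : H | `|x| <= 1]).

(* K is the everywhere defined inverse of D - lam *)
Definition is_resolvent (D : set (H * H)) (lam : R[i]) (K : H -> H) : Prop :=
  forall x y, D (x, y + lam *: x) <-> x = K y.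

Definition has_compact_resolvent (D : set (H * H)) : Prop :=
  exists (lam : R[i]) (K : {linear H -> H}),
    is_resolvent D lam K /\ compact_operator K.

Definition bounded_commutator (D : set (H * H)) (a : H -> H) : Prop :=
  (forall x, domain D x -> domain D (a x)) /\
  exists M : R, forall x y z, D (x, y) -> D (a x, z) ->
    `|z - a y| <= M%:C * `|x|.

(* the unital *-subalgebra of B(H) generated by a set S of bounded operators *)
Inductive star_algebra (S : set (H -> H)) : set (H -> H) :=
| star_gen a : S a -> star_algebra S a
| star_one : star_algebra S id
| star_add a b : star_algebra S a -> star_algebra S b ->
    star_algebra S (fun x => a x + b x)
| star_scale (c : R[i]) a : star_algebra S a ->
    star_algebra S (fun x => c *: a x)
| star_mul a b : star_algebra S a -> star_algebra S b ->
    star_algebra S (a \o b)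
| star_adj a b : star_algebra S a -> (forall x y, dot (a x) y = dot x (b y)) ->
    star_algebra S b.

(* The algebra enters only through its dense *-subalgebra Af and through its
   faithful action on H, so Af is given as a set of operators on H. *)
Definition odd_spectral_triple (Af : set (H -> H)) (D : set (H * H)) : Prop :=
  [/\ self_adjoint D, has_compact_resolvent D
    & forall a, Af a -> bounded_commutator D a].

End UnboundedOperators.

(** Half-integer indices are encoded by natural numbers: the basis vector
    e^(n)_{ij} is [e m k l] with m = 2n, k = n + i and l = n + j, so that the
    admissible indices are those with k <= m and l <= m.  The values of [e] at
    other indices are irrelevant. *)
Section QuantumSU2.
Variables (R : realType) (H : completeNormedModType R[i]).
Variable dot : {dot H for Num.conj}.
Variable e : nat -> nat -> nat -> H.

Definition fin_comb (N : nat) (c : nat -> nat -> nat -> R[i])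
    (v : nat -> nat -> nat -> H) : H :=
  \sum_(m < N) \sum_(k < m.+1) \sum_(l < m.+1) c m k l *: v m k l.

Definition basis_span : set H := [set x | exists N c, x = fin_comb N c e].

Definition orthonormal_basis : Prop :=
  (forall m k l m' k' l', (k <= m)%N -> (l <= m)%N ->
      (k' <= m')%N -> (l' <= m')%N ->
      dot (e m k l) (e m' k' l')
      = ([&& m == m', k == k' & l == l'])%:R) /\
  dense basis_span.

Variable q : R.

Definition a_plus (m k l : nat) : R :=
  Num.sqrt (q ^+ (2 * k + 2 * l + 2) *
    ((1 - q ^+ (2 * (m - l) + 2)) * (1 - q ^+ (2 * (m - k) + 2))
     / ((1 - q ^+ (2 * m + 2)) * (1 - q ^+ (2 * m + 4))))).

Definition a_minus (m k l : nat) : R :=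
  Num.sqrt ((1 - q ^+ (2 * l)) * (1 - q ^+ (2 * k))
     / ((1 - q ^+ (2 * m)) * (1 - q ^+ (2 * m + 2)))).

Definition b_plus (m k l : nat) : R :=
  - Num.sqrt (q ^+ (2 * l) *
    ((1 - q ^+ (2 * (m - l) + 2)) * (1 - q ^+ (2 * k + 2))
     / ((1 - q ^+ (2 * m + 2)) * (1 - q ^+ (2 * m + 4))))).

Definition b_minus (m k l : nat) : R :=
  Num.sqrt (q ^+ (2 * k) *
    ((1 - q ^+ (2 * l)) * (1 - q ^+ (2 * (m - k)))
     / ((1 - q ^+ (2 * m)) * (1 - q ^+ (2 * m + 2))))).

(* Whenever the second basis vector in one of the last two formulas is out of
   range, i.e. k = 0 or l = 0 for alpha and k = m or l = 0 for beta, its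
   coefficient vanishes. *)
Definition SUq2_action (alpha beta : {linear H -> H}) : Prop :=
  [/\ continuous alpha, continuous beta,
      forall m k l, (k <= m)%N -> (l <= m)%N ->
        alpha (e m k l) = (a_plus m k l)%:C *: e m.+1 k l
                        + (a_minus m k l)%:C *: e m.-1 k.-1 l.-1
    & forall m k l, (k <= m)%N -> (l <= m)%N ->
        beta (e m k l) = (b_plus m k l)%:C *: e m.+1 k.+1 l
                       + (b_minus m k l)%:C *: e m.-1 k l.-1].

Definition SUq2_Af (alpha beta : {linear H -> H}) : set (H -> H) :=
  star_algebra dot [set a | a = (alpha : H -> H) \/ a = (beta : H -> H)].

(* the operator with domain [basis_span] sending e m k l to v m k l *)
Definition op_on_span (v : nat -> nat -> nat -> H) : set (H * H) :=
  [set p | exists N c, p = (fin_comb N c e, fin_comb N c v)].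

Definition half (m : nat) : R := m%:R / 2.

Definition A0 : set (H * H) :=
  op_on_span (fun m k l =>
    let j := l%:R - half m in (q `^ j)%:C *: e m k l).

Definition A1 : set (H * H) :=
  op_on_span (fun m k l =>
    let n := half m in let j := l%:R - n in
    if (l < m)%N then
      (Num.sqrt (q `^ (- 2 * n) + q `^ (2 * n + 2)
                 - q `^ (- 2 * j) - q `^ (2 * j + 2)))%:C *: e m k l.+1
    else 0).

(* D T = T D on the algebraic span of the basis *)
Definition commutes (D T : set (H * H)) : Prop :=
  forall x, basis_span x ->
    exists y z w, [/\ D (x, y), T (x, z), T (y, w) & D (z, w)].

(* The self-adjoint operator e^(n)_{ij} |-> d(n,i) e^(n)_{ij}, on its maximal
   domain; d(n,i) is [d m k] with m = 2n, k = n + i, and only the values with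
   k <= m matter. *)
Definition diagonal_operator (d : nat -> nat -> R) : set (H * H) :=
  [set p | forall m k l, (k <= m)%N -> (l <= m)%N ->
     dot p.2 (e m k l) = (d m k)%:C * dot p.1 (e m k l)].

(* The diagonal form is the standing convention on equivariant operators; it
   does not follow from the three commutation relations. *)
Definition equivariant (D : set (H * H)) : Prop :=
  [/\ commutes D A0, commutes D A1, commutes D (adjoint dot A1)
    & exists d, D = diagonal_operator d].

Definition equivariant_spectral_triple (alpha beta : {linear H -> H})
    (D : set (H * H)) : Prop :=
  odd_spectral_triple dot (SUq2_Af alpha beta) D /\ equivariant D.

End QuantumSU2.

Section Growth.
Variable R : realType.
Variable d : nat -> nat -> R.

(* d(n+1/2, i+1/2) - d(n, i) = O(1) *)
Definition growth_diag : Prop :=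
  exists M : R, forall m k, (k <= m)%N -> `|d m.+1 k.+1 - d m k| <= M.

(* d(n+1/2, i-1/2) - d(n, i) = O(n+i+1) *)
Definition growth_antidiag : Prop :=
  exists M : R, forall m k, (k <= m)%N -> `|d m.+1 k - d m k| <= M * k.+1%:R.

(* d((b+a)/2, (b-a)/2) is d (b + a) b *)
Definition T_set (k : nat) : set R :=
  [set x | exists a b, (k < a)%N /\ x = d (b + a) b].

Definition S_set (l r : nat) : set R :=
  [set x | exists b, (l < b)%N /\ x = d (b + r) b].

Definition one_sided (N : R) (X : set R) : Prop :=
  X `<=` [set x | x > N] \/ X `<=` [set x | x < - N].

Definition sign_condition : Prop :=
  forall N : R, 0 <= N ->
    exists k l : nat,
      [/\ (0 < k)%N, (0 < l)%N, one_sided N (T_set k)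
        & forall r, (r <= k)%N -> one_sided N (S_set l r)].

End Growth.

(* Main.v *)
Require Import Defs.
From HB Require Import structures.
From mathcomp Require Import all_boot all_order all_algebra.
From mathcomp Require Import complex ring lra zify.
From mathcomp Require Import all_classical all_reals all_analysis.
Import Order.TTheory GRing.Theory Num.Theory.
Import numFieldNormedType.Exports.
Local Open Scope classical_set_scope.
Local Open Scope ring_scope.
Local Open Scope complex_scope.

Set Implicit Arguments.
Unset Strict Implicit.
Unset Printing Implicit Defensive.

(** The characterization reduces to three facts about a diagonal operator D
    with eigenvalues d(n,i) on the orthonormal basis of matrix entries.

    Commutators.  The generators alpha and beta are sums of two weighted
    shifts of the basis, and the commutator of D with a weighted shift is the
    same shift with its weights multiplied by increments of d.  All weights
    are at most (1 - q^2)^-1; the weights a_+ and b_-, which belong to the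
    steps keeping n + i fixed, carry a further factor q^(n+i), and this
    absorbs an increment O(n+i+1) because (k+1) q^k is bounded.  Hence the
    growth conditions make both commutators bounded on finite combinations.
    The symmetry of D and the representation theorem of Riesz then show that
    the generators preserve the domain ([bounded_commutator_of_basis]), and
    both properties pass to the whole *-algebra
    ([star_algebra_almost_commuting]).  Conversely, a matrix coefficient of
    the commutator with beta at j = -n bounds the increments of d along all
    diagonals n - i = constant, since b_+ stays away from zero there; the
    same coefficient for alpha is bounded below only at i = j = -n.  Moving
    any other antidiagonal increment down to i = -n along two neighbouring
    diagonals costs a multiple of n + i, which is the linear bound
    ([growth_antidiag_of_boundary]).

    Compactness.  The resolvent of D is compact exactly when every bounded
    interval contains finitely many eigenvalues, counted with multiplicity
    ([finite_of_compact_resolvent], [compact_resolvent_of_finite]); since all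
    multiplicities are finite this says that |d| tends to infinity with n.

    Signs.  Once |d| exceeds the increments along a sequence of indices, d
    cannot change sign along it.  A diagonal n - i = constant is such a
    sequence, and so is the boundary i = -n, which links all diagonals far
    from the origin; this turns the divergence of |d| into the sign condition
    ([sign_condition_of_diverges]), while the converse is immediate.

    Commutation with A_0, A_1 and the adjoint of A_1 holds for every such D,
    as these operators leave n and i unchanged. *)

(** * Real-valued norms *)

(** The norm of a complex normed module takes its values in the complex
    numbers; its real version lives in an ordered field, where estimates can
    be computed. *)
Definition rnorm (R : realType) (V : normedZmodType R[i]) (x : V) : R :=
  complex.Re `|x|.

Section RealNorm.
Variables (R : realType) (V : normedZmodType R[i]).
Implicit Types (x y : V).

Lemma rnormE x : `|x| = (rnorm x)%:C.
Proof. by rewrite /rnorm RRe_real// normr_real. Qed.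

Lemma rnorm_ge0 x : 0 <= rnorm x.
Proof. by rewrite -lecR -rnormE normr_ge0. Qed.

Lemma rnorm_le x (M : R) : (`|x| <= M%:C) = (rnorm x <= M).
Proof. by rewrite rnormE lecR. Qed.

Lemma rnorm_lt x (M : R) : (`|x| < M%:C) = (rnorm x < M).
Proof. by rewrite rnormE ltcR. Qed.

Lemma rnorm0 : rnorm (0 : V) = 0.
Proof. by rewrite /rnorm normr0. Qed.

Lemma rnorm0_eq0 x : rnorm x = 0 -> x = 0.
Proof. by move=> h; apply/normr0_eq0; rewrite rnormE h. Qed.

Lemma rnormN x : rnorm (- x) = rnorm x.
Proof. by rewrite /rnorm normrN. Qed.

Lemma rnorm_distC x y : rnorm (x - y) = rnorm (y - x).
Proof. by rewrite /rnorm distrC. Qed.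

Lemma rnormD x y : rnorm (x + y) <= rnorm x + rnorm y.
Proof. by rewrite -lecR rmorphD/= -!rnormE ler_normD. Qed.

Lemma rnormB x y : rnorm (x - y) <= rnorm x + rnorm y.
Proof. by rewrite -(rnormN y) rnormD. Qed.

Lemma rnorm_distD z x y : rnorm (x - y) <= rnorm (x - z) + rnorm (z - y).
Proof. by rewrite -lecR rmorphD/= -!rnormE ler_distD. Qed.

End RealNorm.

Section ComplexModulus.
Variable R : realType.
Implicit Types (z w : R[i]) (r : R).

Lemma rnormM z w : rnorm (z * w) = rnorm z * rnorm w.
Proof. by apply: complexI; rewrite rmorphM/= -!rnormE normrM. Qed.

Lemma rnormc r : rnorm (r%:C : R[i]) = `|r|.
Proof.
by apply: complexI; rewrite -rnormE normc_def/= expr0n/= addr0 sqrtr_sqr.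
Qed.

Lemma rnorm1 : rnorm (1 : R[i]) = 1.
Proof. by rewrite -[1]/(1%:C) rnormc normr1. Qed.

Lemma mul_conj_rnorm z : z * Num.conj z = (rnorm z ^+ 2)%:C.
Proof. by rewrite -normCK rnormE rmorphXn. Qed.

Lemma conj_real r : Num.conj (r%:C : R[i]) = r%:C.
Proof. exact: conjc_real. Qed.

Lemma rnormV z : rnorm z^-1 = (rnorm z)^-1.
Proof. by apply: complexI; rewrite fmorphV/= -!rnormE normfV. Qed.

Lemma rnormZ (V : normedModType R[i]) z (x : V) : rnorm (z *: x) = rnorm z * rnorm x.
Proof. by apply: complexI; rewrite rmorphM/= -!rnormE normrZ. Qed.

End ComplexModulus.

Lemma complex_posE (R : realType) (e : R[i]) : 0 < e ->
  e = (complex.Re e)%:C /\ 0 < complex.Re e.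
Proof. by move=> e0; rewrite -ltcR RRe_real// gtr0_real. Qed.

Lemma rnorm_ReIm (R : realType) (z : R[i]) :
  rnorm z ^+ 2 = complex.Re z ^+ 2 + complex.Im z ^+ 2.
Proof. by apply: complexI; rewrite add_Re2_Im2 rmorphXn/= -rnormE. Qed.

Lemma ler_of_sqr (R : realType) (x y : R) : 0 <= y -> x ^+ 2 <= y ^+ 2 -> x <= y.
Proof. by move=> y0 h; nra. Qed.

(** * Inner products *)

Section InnerProduct.
Variables (R : realType) (H : completeNormedModType R[i]).
Variable dot : {dot H for Num.conj}.
Hypothesis dot_norm : hilbert_norm dot.
Implicit Types (x y z : H).

Lemma dotDl x y z : dot (x + y) z = dot x z + dot y z.
Proof. exact: linearDl. Qed.
Lemma dotDr x y z : dot x (y + z) = dot x y + dot x z.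
Proof. exact: linearDr. Qed.
Lemma dotBl x y z : dot (x - y) z = dot x z - dot y z.
Proof. exact: linearBl. Qed.
Lemma dotBr x y z : dot x (y - z) = dot x y - dot x z.
Proof. exact: linearBr. Qed.
Lemma dotZl c x y : dot (c *: x) y = c * dot x y.
Proof. exact: linearZl_LR. Qed.
Lemma dotZr c x y : dot x (c *: y) = Num.conj c * dot x y.
Proof. exact: linearZr_LR. Qed.
Lemma dot0l x : dot 0 x = 0. Proof. exact: linear0l. Qed.
Lemma dot0r x : dot x 0 = 0. Proof. exact: linear0r. Qed.
Lemma dotC x y : dot x y = Num.conj (dot y x).
Proof. by rewrite hermC/= expr0 mul1r. Qed.
Lemma dot_suml (I : Type) (s : seq I) (f : I -> H) y :
  dot (\sum_(i <- s) f i) y = \sum_(i <- s) dot (f i) y.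
Proof. exact: linear_sumlz. Qed.
Lemma dot_sumr (I : Type) (s : seq I) (f : I -> H) y :
  dot y (\sum_(i <- s) f i) = \sum_(i <- s) dot y (f i).
Proof. exact: linear_sumr. Qed.

Lemma dot_rnorm x : dot x x = (rnorm x ^+ 2)%:C.
Proof. by rewrite -dot_norm rnormE rmorphXn. Qed.

Lemma rnorm_pythagoras x y : dot x y = 0 ->
  rnorm (x + y) ^+ 2 = rnorm x ^+ 2 + rnorm y ^+ 2.
Proof.
move=> xy; have yx : dot y x = 0 by rewrite dotC xy conjC0.
apply: complexI; rewrite rmorphD/= -!dot_rnorm dotDl !dotDr xy yx.
by rewrite addr0 add0r.
Qed.

Lemma cauchy_schwarz x y : rnorm (dot x y) <= rnorm x * rnorm y.
Proof.
have [->|y0] := eqVneq y 0; first by rewrite dot0r !rnorm0 mulr0.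
have ny : dot y y != 0.
  by apply: contra y0; rewrite -dot_norm sqrf_eq0 normr_eq0.
pose a := dot x y / dot y y.
have o : dot (x - a *: y) (a *: y) = 0.
  by rewrite dotZr dotBl dotZl divfK ?subrr ?mulr0.
have := rnorm_pythagoras o; rewrite subrK => e.
have le : rnorm (a *: y) <= rnorm x.
  by apply: ler_of_sqr; rewrite ?rnorm_ge0// e lerDr sqr_ge0.
have nyE : rnorm (dot y y) = rnorm y ^+ 2.
  by rewrite dot_rnorm rnormc ger0_norm ?sqr_ge0.
have ny0 : rnorm y != 0 by apply: contraNneq y0 => /rnorm0_eq0 ->.
move: le; rewrite rnormZ /a rnormM rnormV nyE => le.
rewrite -[leLHS](_ : rnorm (dot x y) * (rnorm y ^+ 2)^-1 * rnorm y * rnorm y = _).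
  by rewrite ler_wpM2r ?rnorm_ge0.
by field.
Qed.

End InnerProduct.

Lemma continuous_linear_rnorm_bound (R : realType) (V : normedModType R[i])
    (a : {linear V -> V}) :
  continuous a -> exists2 A : R, 0 <= A & forall x, rnorm (a x) <= A * rnorm x.
Proof.
move=> /linear_bounded_continuous/linear_boundedP/pinfty_ex_gt0[M M0 hM].
have [ME M0'] := complex_posE M0; exists (complex.Re M); first exact: ltW.
by move=> x; rewrite -lecR rmorphM/= -ME -!rnormE.
Qed.

Lemma cauchy_seq_cvg (R : realType) (H : completeNormedModType R[i])
    (u : nat -> H) :
  (forall e : R, 0 < e -> exists N, forall m n, (N <= n <= m)%N ->
     rnorm (u m - u n) < e) ->
  exists z, forall e : R, 0 < e -> exists N, forall n, (N <= n)%N ->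
     rnorm (z - u n) < e.
Proof.
move=> uC.
have : cvg (u @ \oo).
  apply/cauchy_cvgP/cauchy_exP => e /complex_posE[-> e0].
  have [N hN] := uC _ e0; exists (u N); exists N => // n /= Nn.
  by rewrite -ball_normE /ball_/= rnorm_lt rnorm_distC hN// leqnn.
move=> /cvg_ex[z /cvg_ballP uz]; exists z => e e0.
have /uz[N _ hN] : 0 < e%:C :> R[i] by rewrite ltcR.
exists N => n Nn; have := hN n Nn.
by rewrite /= -ball_normE /ball_/= rnorm_lt.
Qed.

(** * Orthonormal families *)

Section OrthonormalFamilies.
Variables (R : realType) (H : completeNormedModType R[i]).
Variable dot : {dot H for Num.conj}.
Hypothesis dot_norm : hilbert_norm dot.
Variables (I : countType) (E : I -> H).
Hypothesis orthoE : forall i j, dot (E i) (E j) = (i == j)%:R.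
Implicit Types (x y z : H) (s t : seq I) (c d : I -> R[i]).

Definition lin_comb s c : H := \sum_(i <- s) c i *: E i.

Definition fourier x i : R[i] := dot x (E i).

Definition fourier_sum s x : H := lin_comb s (fourier x).

Lemma fourierB x y i : fourier (x - y) i = fourier x i - fourier y i.
Proof. exact: dotBl. Qed.

Lemma fourierD x y i : fourier (x + y) i = fourier x i + fourier y i.
Proof. exact: dotDl. Qed.

Lemma fourierZ k x i : fourier (k *: x) i = k * fourier x i.
Proof. exact: dotZl. Qed.

Lemma fourier0 i : fourier 0 i = 0.
Proof. exact: dot0l. Qed.

Lemma fourierE j i : fourier (E j) i = (j == i)%:R.
Proof. exact: orthoE. Qed.

Lemma rnorm_E i : rnorm (E i) = 1.
Proof.
have h : rnorm (E i) ^+ 2 = 1.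
  by apply: complexI; rewrite -(dot_rnorm dot_norm) orthoE eqxx.
by have := rnorm_ge0 (E i); nra.
Qed.

Lemma rnorm_fourier x i : rnorm (fourier x i) <= rnorm x.
Proof. by rewrite -[leRHS]mulr1 -(rnorm_E i); exact: cauchy_schwarz. Qed.

(** Allowing a reindexing f makes Pythagoras apply to weighted shifts; f need
    only be injective where the weight is nonzero, so its values at the
    indices which the shift kills are arbitrary. *)
Lemma rnorm_reindexed_comb s c (f : I -> I) :
  uniq s ->
  {in s &, forall i j, c i != 0 -> c j != 0 -> f i = f j -> i = j} ->
  rnorm (\sum_(i <- s) c i *: E (f i)) ^+ 2 = \sum_(i <- s) rnorm (c i) ^+ 2.
Proof.
elim: s => [|i s IH] /=; first by rewrite !big_nil rnorm0 expr0n.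
move=> /andP[si us] inj; rewrite !big_cons (rnorm_pythagoras dot_norm).
  rewrite IH//; last first.
    by move=> j k js ks; apply: inj; rewrite inE ?js ?ks orbT.
  congr (_ + _); apply: complexI.
  rewrite -(dot_rnorm dot_norm) dotZl dotZr orthoE eqxx mulr1.
  by rewrite mul_conj_rnorm.
rewrite (dot_sumr dot) big_seq big1// => j js; rewrite dotZl dotZr orthoE.
have [fij|] := eqVneq (f i) (f j); last by rewrite !mulr0.
have [->|ci] := eqVneq (c i) 0; first by rewrite mul0r.
have [->|cj] := eqVneq (c j) 0; first by rewrite conjC0 mul0r mulr0.
have ij : i = j by apply: inj; rewrite ?inE ?eqxx ?js ?orbT.
by rewrite ij js in si.
Qed.

Lemma rnorm_lin_comb s c : uniq s ->
  rnorm (lin_comb s c) ^+ 2 = \sum_(i <- s) rnorm (c i) ^+ 2.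
Proof. by move=> us; rewrite rnorm_reindexed_comb. Qed.

Lemma dot_lin_combr x s c :
  dot x (lin_comb s c) = \sum_(i <- s) fourier x i * Num.conj (c i).
Proof. by rewrite dot_sumr; apply: eq_bigr => i _; rewrite dotZr mulrC. Qed.

Lemma fourier_lin_comb s c j :
  uniq s -> fourier (lin_comb s c) j = if j \in s then c j else 0.
Proof.
move=> us; rewrite /fourier dot_suml.
under eq_bigr do rewrite dotZl orthoE.
have [js|js] := boolP (j \in s).
  rewrite (bigD1_seq j)//= eqxx mulr1 big1 ?addr0// => i ij.
  by rewrite (negPf ij) mulr0.
rewrite big_seq big1// => i si; case: eqP => [ij|_]; last by rewrite mulr0.
by rewrite -ij si in js.
Qed.

Lemma fourier_fourier_sum s x j : uniq s ->
  fourier (fourier_sum s x) j = if j \in s then fourier x j else 0.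
Proof. exact: fourier_lin_comb. Qed.

Lemma rnorm_sub_lin_comb s t c x : uniq s -> {subset t <= s} ->
  rnorm (x - lin_comb t c) ^+ 2 =
    rnorm (x - fourier_sum s x) ^+ 2 + rnorm (fourier_sum s x - lin_comb t c) ^+ 2.
Proof.
move=> us ts; rewrite -(rnorm_pythagoras dot_norm) ?subrKA//.
have o i : i \in s -> fourier (x - fourier_sum s x) i = 0.
  by move=> si; rewrite fourierB fourier_fourier_sum// si subrr.
rewrite dotBr !dot_lin_combr !big_seq big1; last by move=> i si; rewrite o ?mul0r.
by rewrite big1 ?subrr// => i /ts si; rewrite o ?mul0r.
Qed.

(** The difference x - fourier_sum s x is orthogonal to every E i with i in s. *)
Lemma best_approximation s t c x : uniq s -> {subset t <= s} ->
  rnorm (x - fourier_sum s x) <= rnorm (x - lin_comb t c).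
Proof.
move=> us ts; apply: ler_of_sqr; first exact: rnorm_ge0.
by rewrite (rnorm_sub_lin_comb _ _ us ts) lerDl sqr_ge0.
Qed.

Lemma rnorm_fourier_sum s x : uniq s -> rnorm (fourier_sum s x) <= rnorm x.
Proof.
move=> us; apply: ler_of_sqr; first exact: rnorm_ge0.
have := @rnorm_sub_lin_comb s [::] (fun=> 0) x us (fun=> fun h => match notF h with end).
by rewrite /lin_comb big_nil !subr0 => ->; rewrite lerDr sqr_ge0.
Qed.

Lemma bessel s x : uniq s -> \sum_(i <- s) rnorm (fourier x i) ^+ 2 <= rnorm x ^+ 2.
Proof.
move=> us; rewrite -rnorm_lin_comb// -/(fourier_sum s x).
by have := rnorm_fourier_sum x us; have := rnorm_ge0 (fourier_sum s x); nra.
Qed.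

(** Finite combinations, described through their own Fourier sum rather than
    through arbitrary coefficients: two such vectors are then expanded over
    the same list just by enlarging it. *)
Definition finite_expansion (x : H) : Prop :=
  exists2 s, uniq s & x = fourier_sum s x.

Lemma finite_expansion_widen s t x : uniq t -> {subset s <= t} ->
  x = fourier_sum s x -> x = fourier_sum t x.
Proof.
move=> ut st xs; apply/eqP; rewrite -subr_eq0; apply/eqP/rnorm0_eq0/eqP.
rewrite eq_le rnorm_ge0 andbT.
have := best_approximation (fourier x) x ut st.
by rewrite -/(fourier_sum s x) -xs subrr rnorm0.
Qed.

Lemma finite_expansionP k x y :
  finite_expansion x -> finite_expansion y -> finite_expansion (k *: x + y).
Proof.
move=> [s us xs] [t ut yt]; pose u := undup (s ++ t).
have uu : uniq u by exact: undup_uniq.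
have xu : x = fourier_sum u x.
  by apply: finite_expansion_widen xs => // i si; rewrite mem_undup mem_cat si.
have yu : y = fourier_sum u y.
  by apply: finite_expansion_widen yt => // i ti; rewrite mem_undup mem_cat ti orbT.
exists u => //; rewrite {1}xu {1}yu scaler_sumr -big_split/=.
by apply: eq_bigr => i _; rewrite scalerA -scalerDl fourierD fourierZ.
Qed.

Lemma finite_expansion_E i : finite_expansion (E i).
Proof.
exists [:: i] => //.
by rewrite /fourier_sum /lin_comb big_seq1 fourierE eqxx scale1r.
Qed.

Lemma finite_expansion_sum (J : Type) (r : seq J) (F : J -> H) :
  (forall j, finite_expansion (F j)) -> finite_expansion (\sum_(j <- r) F j).
Proof.
move=> h; elim: r => [|j r IH].
  by rewrite big_nil; exists [::] => //; rewrite /fourier_sum /lin_comb big_nil.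
by rewrite big_cons -[F j]scale1r; exact: finite_expansionP.
Qed.

Definition indices (n : nat) : seq I := pmap pickle_inv (iota 0 n).

Lemma pmap_pickle_inv_uniq (s : seq nat) : uniq s -> uniq (pmap (@pickle_inv I) s).
Proof. by apply: pmap_uniq; exact: pickle_invK. Qed.

Lemma mem_indices n i : (pickle i < n)%N -> i \in indices n.
Proof.
move=> h; rewrite mem_pmap; apply/mapP; exists (pickle i).
  by rewrite mem_iota.
by rewrite pickleK_inv.
Qed.

Lemma indices_cat m n : (n <= m)%N ->
  indices m = indices n ++ pmap pickle_inv (iota n (m - n)).
Proof. by move=> le_nm; rewrite -{1}(subnKC le_nm) /indices iotaD pmap_cat. Qed.

(** The squared norms of the partial sums along the exhaustion [indices] form
    a bounded nondecreasing sequence, so these partial sums are Cauchy. *)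
Lemma riesz_fischer c (M : R) : 0 <= M ->
  (forall s, uniq s -> \sum_(i <- s) rnorm (c i) ^+ 2 <= M ^+ 2) ->
  exists2 z, forall i, fourier z i = c i & rnorm z <= M.
Proof.
move=> M0 cM.
pose u n := lin_comb (indices n) c.
pose v n := \sum_(i <- indices n) rnorm (c i) ^+ 2.
have uI n : uniq (indices n) by apply: pmap_pickle_inv_uniq; exact: iota_uniq.
have uv m n : (n <= m)%N -> rnorm (u m - u n) ^+ 2 = v m - v n.
  move=> le_nm; have := uI m.
  rewrite /u /v /lin_comb (indices_cat le_nm) !big_cat/= cat_uniq => /and3P[_ _ us].
  have addKl (W : zmodType) (a b : W) : a + b - a = b by rewrite addrC addKr.
  by rewrite !addKl -rnorm_lin_comb.
have hs : has_sup (range v).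
  split; first by exists (v 0%N), 0%N.
  by exists (M ^+ 2) => _ [n _ <-]; exact: cM.
have [|z hz] := @cauchy_seq_cvg _ _ u.
  move=> e e0; have e20 : 0 < e ^+ 2 by rewrite exprn_gt0.
  have [_ [N _ <-] hN] := sup_adherent e20 hs.
  exists N => m n /andP[Nn le_nm].
  have h1 : v m <= sup (range v) by apply: ub_le_sup; [exact: hs.2|exists m].
  have h2 : v N <= v n by rewrite -subr_ge0 -uv// sqr_ge0.
  have := uv _ _ le_nm; have := rnorm_ge0 (u m - u n); nra.
exists z => [i|].
  apply/eqP; rewrite -subr_eq0; apply/eqP/rnorm0_eq0/eqP.
  rewrite eq_le rnorm_ge0 andbT; apply/ler_addgt0Pl => e e0; rewrite addr0.
  have [N hN] := hz _ e0; pose n := maxn N (pickle i).+1.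
  have -> : c i = fourier (u n) i.
    by rewrite fourier_lin_comb// mem_indices// leq_maxr.
  by rewrite -fourierB; apply: (le_trans (rnorm_fourier _ _)); apply/ltW/hN/leq_maxl.
apply/ler_addgt0Pl => e e0; have [N hN] := hz _ e0.
rewrite -[z](subrK (u N)); apply: (le_trans (rnormD _ _)).
apply: lerD; first exact/ltW/hN.
by apply: ler_of_sqr => //; rewrite rnorm_lin_comb// cM.
Qed.

(** The bound, tested on the coefficients c themselves, shows that c is square
    summable. *)
Lemma riesz_representation c (M : R) : 0 <= M ->
  (forall s d, uniq s -> rnorm (\sum_(i <- s) c i * Num.conj (d i)) <= M * rnorm (lin_comb s d)) ->
  exists2 z, forall i, fourier z i = c i & rnorm z <= M.
Proof.
move=> M0 cM; apply: riesz_fischer => // s us.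
have sqE : \sum_(i <- s) c i * Num.conj (c i) = (rnorm (lin_comb s c) ^+ 2)%:C.
  by rewrite rnorm_lin_comb// rmorph_sum; apply: eq_bigr => i _; exact: mul_conj_rnorm.
have := cM s c us; rewrite sqE rnormc ger0_norm ?sqr_ge0// -rnorm_lin_comb//.
by have := rnorm_ge0 (lin_comb s c); nra.
Qed.

Section Basis.
Hypothesis denseE : forall x (e : R), 0 < e -> exists s c, rnorm (x - lin_comb s c) < e.

Lemma fourier_sum_cvg x (e : R) : 0 < e ->
  exists2 s, uniq s & forall t, uniq t -> {subset s <= t} -> rnorm (x - fourier_sum t x) < e.
Proof.
move=> e0; have [s [c h]] := denseE x e0.
exists (undup s); first exact: undup_uniq.
move=> t ut st; apply: le_lt_trans h; apply: best_approximation => // i si.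
by apply: st; rewrite mem_undup.
Qed.

Lemma fourier_sum_cvg2 x y (e : R) : 0 < e ->
  exists2 s, uniq s & rnorm (x - fourier_sum s x) < e /\ rnorm (y - fourier_sum s y) < e.
Proof.
move=> e0; have [s us hs] := fourier_sum_cvg x e0; have [t ut ht] := fourier_sum_cvg y e0.
exists (undup (s ++ t)); first exact: undup_uniq.
split; [apply: hs|apply: ht]; rewrite ?undup_uniq// => i;
  by rewrite mem_undup mem_cat => ->; rewrite ?orbT.
Qed.

Lemma rnorm_le_of_fourier x (M : R) : 0 <= M ->
  (forall s, uniq s -> \sum_(i <- s) rnorm (fourier x i) ^+ 2 <= M ^+ 2) -> rnorm x <= M.
Proof.
move=> M0 h; apply/ler_addgt0Pl => e e0; have [s us hs] := fourier_sum_cvg x e0.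
rewrite -[x](subrK (fourier_sum s x)); apply: (le_trans (rnormD _ _)).
apply: lerD; first exact/ltW/hs.
by apply: ler_of_sqr => //; rewrite rnorm_lin_comb// h.
Qed.

Lemma fourier_inj x y : (forall i, fourier x i = fourier y i) -> x = y.
Proof.
move=> h; apply/eqP; rewrite -subr_eq0; apply/eqP/rnorm0_eq0/eqP.
rewrite eq_le rnorm_ge0 andbT; apply: rnorm_le_of_fourier => // s _.
by rewrite expr0n/= big1// => i _; rewrite fourierB h subrr rnorm0 expr0n.
Qed.

End Basis.
End OrthonormalFamilies.

(** * Diagonal operators and bounded commutators *)

Section DiagonalOperators.
Variables (R : realType) (H : completeNormedModType R[i]).
Variable dot : {dot H for Num.conj}.
Hypothesis dot_norm : hilbert_norm dot.
Variables (I : countType) (E : I -> H).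
Hypothesis orthoE : forall i j, dot (E i) (E j) = (i == j)%:R.
Hypothesis denseE : forall x (e : R), 0 < e -> exists s c, rnorm (x - lin_comb E s c) < e.
Implicit Types (x y z : H) (s t : seq I) (c : I -> R[i]).

Variable d : I -> R.

Local Notation coef := (fourier dot E).
Local Notation comb := (lin_comb E).
Local Notation proj := (fourier_sum dot E).

Definition diag : set (H * H) :=
  [set p | forall i, coef p.2 i = (d i)%:C * coef p.1 i].

Lemma diagP (k : R[i]) x y x' y' : diag (x, y) -> diag (x', y') ->
  diag (k *: x + x', k *: y + y').
Proof.
move=> h h' i; have /= e1 := h i; have /= e2 := h' i.
by rewrite /= !fourierD !fourierZ e1 e2 mulrDr mulrCA.
Qed.

Lemma diag0 : diag (0, 0).
Proof. by move=> i; rewrite /= fourier0 mulr0. Qed.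

Lemma diagZ (k : R[i]) x y : diag (x, y) -> diag (k *: x, k *: y).
Proof. by move=> h; have := diagP k h diag0; rewrite !addr0. Qed.

Lemma diagD x y x' y' : diag (x, y) -> diag (x', y') -> diag (x + x', y + y').
Proof. by move=> h h'; have := diagP 1 h h'; rewrite !scale1r. Qed.

Lemma diag_sum (J : Type) (s : seq J) (f g : J -> H) :
  (forall i, diag (f i, g i)) -> diag (\sum_(i <- s) f i, \sum_(i <- s) g i).
Proof.
move=> h; elim: s => [|i s IH]; first by rewrite !big_nil; exact: diag0.
by rewrite !big_cons; exact: diagD.
Qed.

Lemma diag_E i : diag (E i, (d i)%:C *: E i).
Proof.
by move=> j; rewrite /= fourierZ (fourierE orthoE); case: eqP => [->//|_]; rewrite !mulr0.
Qed.

Lemma diag_lin_comb s c : diag (comb s c, comb s (fun i => (d i)%:C * c i)).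
Proof.
apply: diag_sum => i; rewrite mulrC -scalerA; exact/diagZ/diag_E.
Qed.

Lemma diag_fun x y y' : diag (x, y) -> diag (x, y') -> y = y'.
Proof.
move=> h h'; apply: (fourier_inj dot_norm orthoE denseE) => i.
by have /= -> := h i; have /= -> := h' i.
Qed.

(** Both sides are limits of the same finite sum, by replacing y and y' by
    their Fourier sums over a common list. *)
Lemma diag_symmetric x x' y y' : diag (x, x') -> diag (y, y') -> dot x' y = dot x y'.
Proof.
move=> hx hy; apply/eqP; rewrite -subr_eq0; apply/eqP/rnorm0_eq0/eqP.
rewrite eq_le rnorm_ge0 andbT; apply/ler_addgt0Pl => e e0; rewrite addr0.
pose K := rnorm x + rnorm x' + 1.
have K0 : 0 < K by rewrite ltr_wpDl// addr_ge0// rnorm_ge0.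
have [s us [hs hs']] := fourier_sum_cvg2 dot_norm orthoE denseE y y' (divr_gt0 e0 K0).
have sE : dot x' (proj s y) = dot x (proj s y').
  rewrite !dot_lin_combr; apply: eq_bigr => i _.
  have /= -> := hx i; have /= -> := hy i.
  by rewrite rmorphM/= conj_real mulrCA mulrA.
have -> : dot x' y - dot x y' = dot x' (y - proj s y) - dot x (y' - proj s y').
  by rewrite !dotBr sE; ring.
apply: (le_trans (rnormB _ _)).
have h1 := cauchy_schwarz dot_norm x' (y - proj s y).
have h2 := cauchy_schwarz dot_norm x (y' - proj s y').
have h3 : rnorm x' * rnorm (y - proj s y) <= rnorm x' * (e / K) by rewrite ler_wpM2l ?rnorm_ge0// ltW.
have h4 : rnorm x * rnorm (y' - proj s y') <= rnorm x * (e / K) by rewrite ler_wpM2l ?rnorm_ge0// ltW.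
have h5 : (rnorm x + rnorm x') * (e / K) <= e.
  by rewrite mulrA ler_pdivrMr// mulrC ler_wpM2l ?(ltW e0)// /K; lra.
move: h5; rewrite mulrDl; lra.
Qed.

Lemma diag_domain_dense : dense (domain diag).
Proof.
move=> O [x Ox] oO; have /nbhs_ballP[e /= e0 he] := open_nbhs_nbhs (conj oO Ox).
have eE : e = (complex.Re e)%:C by rewrite RRe_real// gtr0_real.
rewrite eE ltcR in e0; have [s [c h]] := denseE x e0.
exists (comb s c); split; last by eexists; exact: diag_lin_comb.
by apply: he; rewrite -ball_normE /ball_/= eE rnorm_lt.
Qed.

Lemma diag_self_adjoint : self_adjoint dot diag.
Proof.
split; first exact: diag_domain_dense.
apply/seteqP; split=> [[x y] h x' y' h'|[x y] h i] /=; first exact: diag_symmetric h' h.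
have /= := h _ _ (diag_E i); rewrite dotZl => hi.
by rewrite /fourier dotC -hi rmorphM/= conj_real -dotC.
Qed.

(** Packing the domain inclusion and the estimate into one correction vector w
    lets commutator bounds compose without side conditions on domains. *)
Lemma bounded_commutatorP (a : H -> H) :
  (exists2 M : R, 0 <= M & forall x y, diag (x, y) ->
     exists2 w, diag (a x, a y + w) & rnorm w <= M * rnorm x)
  <-> bounded_commutator diag a.
Proof.
split=> [[M M0 key]|[dom [M hM]]].
  split=> [x [y /key[w h _]]|]; first by eexists; exact: h.
  exists M => x y z /key[w h hw] /(diag_fun h) <-.
  by rewrite addrC addKr [`|x|]rnormE -rmorphM/= rnorm_le.
exists `|M| => [|x y hxy]; first exact: normr_ge0.
have [|z hz] := dom x; first by exists y.
exists (z - a y); first by rewrite addrC subrK.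
have := hM _ _ _ hxy hz; rewrite [`|x|]rnormE -rmorphM/= rnorm_le => /le_trans; apply.
by rewrite ler_wpM2r ?rnorm_ge0// ler_norm.
Qed.

(** The difference of the two inner products is the would-be functional
    < D u - v, . > with D moved to the finite combination, so the
    representation theorem produces the vector D u - v. *)
Lemma diag_weak u v (M : R) : 0 <= M ->
  (forall s c, uniq s ->
     rnorm (dot u (comb s (fun i => (d i)%:C * c i)) - dot v (comb s c))
     <= M * rnorm (comb s c)) ->
  exists2 w, diag (u, v + w) & rnorm w <= M.
Proof.
move=> M0 h; pose c i := (d i)%:C * coef u i - coef v i.
have [//|s b us|w hw wM] := @riesz_representation _ _ _ dot_norm _ _ orthoE c M.
  have -> : \sum_(i <- s) c i * Num.conj (b i) =
      dot u (comb s (fun i => (d i)%:C * b i)) - dot v (comb s b).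
    rewrite !dot_lin_combr -sumrB; apply: eq_bigr => i _.
    by rewrite rmorphM/= conj_real /c; ring.
  exact: h.
exists w => // i; rewrite /= fourierD hw.
by rewrite /c addrC subrK.
Qed.

(** C i is the value of the commutator at E i.  For x in the domain, the weak
    estimate of [diag_weak] holds for the Fourier sums of x, where D may be
    moved across a, and passes to the limit since a is bounded. *)
Lemma bounded_commutator_of_basis (a : {linear H -> H}) (A M : R) (C : I -> H) :
  0 <= A -> (forall x, rnorm (a x) <= A * rnorm x) -> 0 <= M ->
  (forall i, diag (a (E i), (d i)%:C *: a (E i) + C i)) ->
  (forall s c, uniq s -> rnorm (\sum_(i <- s) c i *: C i) <= M * rnorm (comb s c)) ->
  bounded_commutator diag a.
Proof.
move=> A0 aA M0 hC CM.
apply/bounded_commutatorP; exists M => // x y hxy.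
apply: diag_weak => [|s v us]; first by rewrite mulr_ge0 ?rnorm_ge0.
set V := comb s v; set W := comb s _.
have hV : diag (V, W) := diag_lin_comb s v.
apply/ler_addgt0Pl => e e0; pose K := A * (rnorm W + rnorm V) + 1.
have K0 : 0 < K by rewrite ltr_wpDl// mulr_ge0// addr_ge0// rnorm_ge0.
have [t ut [ht ht']] := fourier_sum_cvg2 dot_norm orthoE denseE x y (divr_gt0 e0 K0).
pose X := proj t x; pose Y := proj t y.
pose Ct := \sum_(i <- t) coef x i *: C i.
have aXY : diag (a X, a Y + Ct).
  rewrite /X /Y /Ct /fourier_sum /lin_comb !linear_sum -big_split/=.
  apply: diag_sum => i; have /= -> := hxy i.
  by rewrite !linearZ/= mulrC -scalerA -scalerDr; exact/diagZ/hC.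
have -> : dot (a x) W - dot (a y) V =
    dot (a (x - X)) W - dot (a (y - Y)) V + dot Ct V.
  rewrite !linearB/= !dotBl -(diag_symmetric aXY hV) dotDl; ring.
apply: (le_trans (rnormD _ _)); apply: lerD.
  apply: (le_trans (rnormB _ _)).
  have h1 := cauchy_schwarz dot_norm (a (x - X)) W.
  have h2 := cauchy_schwarz dot_norm (a (y - Y)) V.
  have h3 : rnorm (a (x - X)) * rnorm W <= A * (e / K) * rnorm W.
    rewrite ler_wpM2r ?rnorm_ge0//; apply: (le_trans (aA _)).
    by rewrite ler_wpM2l// ltW.
  have h4 : rnorm (a (y - Y)) * rnorm V <= A * (e / K) * rnorm V.
    rewrite ler_wpM2r ?rnorm_ge0//; apply: (le_trans (aA _)).
    by rewrite ler_wpM2l// ltW.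
  have h5 : A * (rnorm W + rnorm V) * (e / K) <= e.
    by rewrite mulrA ler_pdivrMr// mulrC ler_wpM2l ?(ltW e0)// /K; lra.
  by move: h5; rewrite mulrDr mulrDl !(mulrAC A (rnorm _)) => h5; lra.
apply: (le_trans (cauchy_schwarz dot_norm _ _)).
rewrite ler_wpM2r ?rnorm_ge0//; apply: (le_trans (CM _ _ ut)).
by rewrite ler_wpM2l// rnorm_fourier_sum.
Qed.

Definition almost_commuting (a : H -> H) : Prop :=
  [/\ linear a, exists2 A : R, 0 <= A & forall x, rnorm (a x) <= A * rnorm x
    & exists2 M : R, 0 <= M & forall x y, diag (x, y) ->
        exists2 w, diag (a x, a y + w) & rnorm w <= M * rnorm x].

(** For an adjoint b of a, the correction D b x - b D x comes from
    [diag_weak]: against a finite combination V, moving b and D to the other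
    side turns it into - < x, [D, a] V >. *)
Lemma star_algebra_almost_commuting (S : set (H -> H)) :
  (forall a, S a -> almost_commuting a) ->
  forall a, star_algebra dot S a -> almost_commuting a.
Proof.
move=> hS a; elim=> {a} [a /hS//|
  |a b _ [la [A A0 hA] [M M0 hM]] _ [lb [B B0 hB] [N N0 hN]]
  |k a _ [la [A A0 hA] [M M0 hM]]
  |a b _ [la [A A0 hA] [M M0 hM]] _ [lb [B B0 hB] [N N0 hN]]
  |a b _ [la [A A0 hA] [M M0 hM]] ab].
- split; first by [].
    by exists 1 => // x; rewrite mul1r.
  exists 0 => // x y h; exists 0; first by rewrite addr0.
  by rewrite rnorm0 mul0r.
- split.
  + by move=> k x y; rewrite la lb scalerDr addrACA.
  + exists (A + B) => [|x]; first exact: addr_ge0.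
    by rewrite mulrDl (le_trans (rnormD _ _))// lerD.
  exists (M + N) => [|x y h]; first exact: addr_ge0.
  have [w hw wM] := hM _ _ h; have [w' hw' wN] := hN _ _ h.
  exists (w + w'); first by rewrite addrACA; exact: diagD.
  by rewrite mulrDl (le_trans (rnormD _ _))// lerD.
- split.
  + by move=> k' x y; rewrite la scalerDr !scalerA mulrC.
  + exists (rnorm k * A) => [|x]; first by rewrite mulr_ge0 ?rnorm_ge0.
    by rewrite rnormZ -mulrA ler_wpM2l ?rnorm_ge0.
  exists (rnorm k * M) => [|x y h]; first by rewrite mulr_ge0 ?rnorm_ge0.
  have [w hw wM] := hM _ _ h; exists (k *: w).
    by rewrite -scalerDr; exact: diagZ.
  by rewrite rnormZ -mulrA ler_wpM2l ?rnorm_ge0.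
- split.
  + by move=> k x y /=; rewrite lb la.
  + exists (A * B) => [|x]; first exact: mulr_ge0.
    by rewrite -mulrA (le_trans (hA _))// ler_wpM2l.
  exists (M * B + A * N) => [|x y h]; first by rewrite addr_ge0 ?mulr_ge0.
  have [w hw wN] := hN _ _ h; have [w' hw' wM] := hM _ _ hw.
  exists (a w + w') => /=.
    rewrite addrA; suff -> : a (b y) + a w = a (b y + w) by [].
    by have := la 1 (b y) w; rewrite !scale1r.
  rewrite (le_trans (rnormD _ _))// addrC mulrDl lerD//.
    by rewrite -mulrA (le_trans wM)// ler_wpM2l.
  by rewrite -mulrA (le_trans (hA _))// ler_wpM2l.
have ba x y : dot (b x) y = dot x (a y) by rewrite dotC -ab -dotC.
split.
- move=> k x y; apply: (fourier_inj dot_norm orthoE denseE) => i.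
  by rewrite /fourier ba !dotDl !dotZl !ba.
- exists A => // x; have h : rnorm (b x) ^+ 2 <= A * rnorm (b x) * rnorm x.
    have -> : rnorm (b x) ^+ 2 = rnorm (dot (a (b x)) x).
      by rewrite ab (dot_rnorm dot_norm) rnormc ger0_norm ?sqr_ge0.
    by rewrite (le_trans (cauchy_schwarz dot_norm _ _))// ler_wpM2r ?rnorm_ge0.
  have := rnorm_ge0 (b x); rewrite le_eqVlt => /predU1P[<-|bx].
    by rewrite mulr_ge0 ?rnorm_ge0.
  by rewrite -(ler_pM2l bx) -expr2 mulrCA mulrA.
exists M => // x y hxy.
apply: diag_weak => [|s v us]; first by rewrite mulr_ge0 ?rnorm_ge0.
set V := comb s v; set W := comb s _.
have hV : diag (V, W) := diag_lin_comb s v.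
  have [u hu uM] := hM _ _ hV.
  rewrite !ba (diag_symmetric hxy hu) dotDr opprD addrA subrr add0r rnormN.
  apply: (le_trans (cauchy_schwarz dot_norm _ _)).
  by rewrite mulrAC mulrC ler_wpM2r ?rnorm_ge0.
Qed.

End DiagonalOperators.

(** * Compact resolvents *)

(** An ultrafilter containing a finite union of small balls contains one of
    them, hence is Cauchy. *)
Lemma precompact_totally_bounded (R : realType) (H : completeNormedModType R[i])
    (A : set H) :
  (forall e : R, 0 < e -> exists L : seq H, forall x, A x ->
     exists2 p, p \in L & rnorm (p - x) < e) ->
  precompact A.
Proof.
move=> tb; rewrite precompactE compact_ultra => F UF FA.
have : cvg F.
  apply/cauchy_cvgP/cauchy_exP => e /complex_posE[-> e0].
  have [L hL] := tb _ (divr_gt0 e0 (@ltr0n R 2)).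
  have : F [set x | exists2 p, p \in L & ball p (complex.Re e)%:C x].
    apply: filterS FA => x Ax.
    have := Ax (ball x (complex.Re e / 2)%:C) _.
    case; first by apply: nbhsx_ballx; rewrite ltcR; lra.
    move=> y [/hL[p pL py] xy]; exists p => //.
    move: xy; rewrite -ball_normE /ball_/= !rnorm_lt => xy.
    by apply: (le_lt_trans (rnorm_distD y _ _)); rewrite [rnorm (y - x)]rnorm_distC; lra.
  elim: L {hL} => [|p L IH] FL.
    by have [x []] := filter_ex FL.
  have [Fp|Fp] := in_ultra_setVsetC (ball p (complex.Re e)%:C) UF; first by exists p.
  apply: IH; apply: filterS (filterI FL Fp) => x [[q]].
  by rewrite inE => /predU1P[->//|qL qx] _; exists q.
move=> Fp; exists (lim F); split => //.
by apply: closed_closure => B /Fp FB; exact: filter_ex (filterI FA FB).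
Qed.

Lemma real_interval_net (R : realType) (e : R) : 0 < e ->
  exists G : seq R, forall r : R, `|r| <= 1 -> exists2 g, g \in G & `|g - r| < e.
Proof.
move=> e0; pose n := (Num.truncn e^-1).+1.
have n0 : (0 : R) < n%:R by rewrite ltr0n.
have ne : n%:R^-1 < e.
  by rewrite invf_plt ?posrE// truncnS_gt.
exists [seq k%:R / n%:R - 1 | k <- iota 0 (2 * n).+1] => r.
rewrite ler_norml => /andP[r1 r2].
have s0 : 0 <= (r + 1) * n%:R by rewrite mulr_ge0 ?ler0n//; lra.
have /andP[k1 k2] := truncn_itv s0; set k := Num.truncn _ in k1 k2.
exists (k%:R / n%:R - 1).
  apply/mapP; exists k => //; rewrite mem_iota/= add0n ltnS.
  rewrite -(ler_nat R) (le_trans k1)// natrM ler_wpM2r ?ler0n//; lra.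
apply: le_lt_trans ne; rewrite ler_norml.
have -> : k%:R / n%:R - 1 - r = (k%:R - (r + 1) * n%:R) / n%:R.
  by field; rewrite gt_eqF.
rewrite -mulNr -[- n%:R^-1]mulN1r -[X in _ <= _ <= X]mul1r !ler_pM2r ?invr_gt0//.
by move: k2; rewrite -natr1; lra.
Qed.

Lemma unit_disc_net (R : realType) (e : R) : 0 < e ->
  exists G : seq R[i], forall z : R[i], rnorm z <= 1 -> exists2 g, g \in G & rnorm (g - z) < e.
Proof.
move=> e0; have [G hG] := real_interval_net (divr_gt0 e0 (@ltr0n R 2)).
exists [seq a +i* b | a <- G, b <- G] => -[x y] z1.
have xy : x ^+ 2 + y ^+ 2 <= 1.
  by rewrite -[leLHS](rnorm_ReIm (x +i* y)) exprn_ile1 ?rnorm_ge0.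
have [a aG ha] : exists2 g, g \in G & `|g - x| < e / 2.
  by apply: hG; rewrite ler_norml; apply/andP; split; nra.
have [b bG hb] : exists2 g, g \in G & `|g - y| < e / 2.
  by apply: hG; rewrite ler_norml; apply/andP; split; nra.
exists (a +i* b); first by apply: allpairs_f.
have := rnorm_ReIm ((a +i* b) - (x +i* y)) => /=.
have := rnorm_ge0 ((a +i* b) - (x +i* y)).
move: ha hb; rewrite !ltr_norml => /andP[a1 a2] /andP[b1 b2].
set u := rnorm _ => u0 uE; rewrite ltNge; apply/negP => eu.
have : (a - x) ^+ 2 < (e / 2) ^+ 2 by nra.
have : (b - y) ^+ 2 < (e / 2) ^+ 2 by nra.
have : e ^+ 2 <= u ^+ 2 by nra.
by move: uE; rewrite /=; nra.
Qed.

Section Resolvents.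
Variables (R : realType) (H : completeNormedModType R[i]).
Variable dot : {dot H for Num.conj}.
Hypothesis dot_norm : hilbert_norm dot.
Variables (I : countType) (E : I -> H).
Hypothesis orthoE : forall i j, dot (E i) (E j) = (i == j)%:R.
Hypothesis denseE : forall x (e : R), 0 < e -> exists s c, rnorm (x - lin_comb E s c) < e.
Variable d : I -> R.

Local Notation coef := (fourier dot E).
Local Notation comb := (lin_comb E).
Local Notation proj := (fourier_sum dot E).
Local Notation diag := (diag dot E d).

Lemma lin_comb_net s (e : R) : 0 < e ->
  exists L : seq H, forall c : I -> R[i], (forall i, rnorm (c i) <= 1) ->
    exists2 p, p \in L & rnorm (p - comb s c) < e.
Proof.
elim: s e => [|i s IH] e e0.
  exists [:: 0] => c _; exists 0; first by rewrite inE.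
  by rewrite /lin_comb big_nil subr0 rnorm0.
have e20 : 0 < e / 2 by rewrite divr_gt0.
have [L hL] := IH _ e20; have [G hG] := unit_disc_net e20.
exists [seq g *: E i + p | g <- G, p <- L] => c c1.
have [p pL hp] := hL c c1; have [g gG hg] := hG _ (c1 i).
exists (g *: E i + p); first by apply/allpairsP; exists (g, p).
rewrite /lin_comb big_cons -/(comb s c) opprD addrACA -scalerBl.
by apply: (le_lt_trans (rnormD _ _)); rewrite rnormZ (rnorm_E dot_norm orthoE) mulr1; lra.
Qed.

(** Distinct vectors K e_i with |d i| <= N are a fixed distance apart, and a
    finite cover by smaller balls separates them. *)
Lemma finite_of_compact_resolvent (N : R) :
  has_compact_resolvent diag -> finite_set [set i | `|d i| <= N].
Proof.
move=> [lam [K [hK [B KB [cB _]]]]].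
have KE i j : ((d j)%:C - lam) * coef (K (E i)) j = (i == j)%:R.
  have /= := (hK (K (E i)) (E i)).2 erefl j.
  by rewrite fourierD fourierZ (fourierE orthoE) mulrBl => <-; rewrite addrK.
have neq i : (d i)%:C - lam != 0.
  by apply: contra_eqN (KE i i) => /eqP ->; rewrite mul0r eqxx eq_sym oner_eq0.
have Kij i j : i != j -> coef (K (E i)) j = 0.
  move=> ij; have /eqP := KE i j.
  by rewrite (negPf ij) mulf_eq0 (negPf (neq j)) => /eqP.
pose L := `|N| + rnorm lam + 1.
have L0 : 0 < L by rewrite ltr_wpDl ?addr_ge0 ?rnorm_ge0.
have far i j : `|d i| <= N -> i != j -> L^-1 <= rnorm (K (E i) - K (E j)).
  move=> dN ij; apply: le_trans (rnorm_fourier dot_norm orthoE _ i).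
  rewrite fourierB (Kij j i) 1?eq_sym// subr0.
  have e : rnorm ((d i)%:C - lam) * rnorm (coef (K (E i)) i) = 1.
    by rewrite -rnormM KE eqxx rnorm1.
  have le : rnorm ((d i)%:C - lam) <= L.
    apply: (le_trans (rnormB _ _)); rewrite rnormc.
    by have := le_trans dN (ler_norm N); rewrite /L; lra.
  rewrite -[L^-1]mul1r ler_pdivrMr// -e mulrC ler_wpM2l ?rnorm_ge0//.
pose r := (L^-1 / 2)%:C : R[i].
have r0 : 0 < r by rewrite ltcR divr_gt0 ?invr_gt0.
move: cB; rewrite compact_cover => /(_ H setT (fun p => (ball p r)^°)).
case=> [p _|x Bx|F _].
- exact: open_interior.
- by exists x => //; exact: nbhsx_ballx.
have finF := finite_fset F; move: finF; set F' := (X in finite_set X) => finF hF.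
have sub : [set i | `|d i| <= N] `<=`
    \bigcup_(p in F') [set i | `|d i| <= N /\ ball p r (K (E i))].
  move=> i dN; have [p pF hp] : cover F' (fun p => (ball p r)^°) (K (E i)).
    by apply: hF; apply: KB; exists (E i) => //=; rewrite rnormE (rnorm_E dot_norm orthoE).
  by exists p => //; split => //; exact: interior_subset hp.
apply: sub_finite_set sub _; apply: bigcup_finite => // p _.
set J := [set i | _]; have [->|/set0P[i [iN ip]]] := eqVneq J set0; first exact: finite_set0.
have : finite_set [set i] by exact: finite_set1.
apply: sub_finite_set => j [jN jp] /=; apply/eqP; apply: contraT => ji.
have := far j i jN ji.
move: ip jp; rewrite -ball_normE /ball_/= !rnorm_lt => ip jp.
by have := rnorm_distD p (K (E j)) (K (E i)); rewrite (rnorm_distC _ p); lra.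
Qed.

(** As d is real, 'i lies at distance at least 1 from the spectrum.  The
    resolvent K multiplies the coordinates by k i, and k i tends to 0, so the
    image of the ball lies within e / 2 of a bounded set in finite
    dimension. *)
Lemma compact_resolvent_of_finite :
  (forall N : R, finite_set [set i | `|d i| <= N]) -> has_compact_resolvent diag.
Proof.
move=> fin; pose k i : R[i] := ((d i)%:C - 'i)^-1.
have rk i : rnorm ((d i)%:C - 'i : R[i]) ^+ 2 = d i ^+ 2 + 1.
  by rewrite rnorm_ReIm/= subr0 sub0r sqrrN expr1n.
have k0 i : (d i)%:C - 'i != 0 :> R[i].
  apply: contra_eqN (rk i) => /eqP ->; rewrite rnorm0 expr0n/= eq_sym.
  by rewrite gt_eqF// ltr_wpDl// sqr_ge0.
have kle (M : R) i : 0 < M -> M <= 1 \/ M <= `|d i| -> rnorm (k i) <= M^-1.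
  move=> M0 h; rewrite /k rnormV lef_pV2 ?posrE//; last first.
    by rewrite lt_neqAle rnorm_ge0 andbT eq_sym; apply: contra (k0 i) => /eqP/rnorm0_eq0/eqP.
  apply: ler_of_sqr; rewrite ?rnorm_ge0// rk.
  case: h => h; first by have := sqr_ge0 (d i); nra.
  by rewrite -(real_normK (num_real (d i))); have := normr_ge0 (d i); nra.
have k1 i : rnorm (k i) <= 1.
  by rewrite -[1]invr1 kle//; left.
have Kex y : exists x, forall i, coef x i = k i * coef y i.
  have [||x hx _] := @riesz_fischer _ _ _ dot_norm _ _ orthoE (fun i => k i * coef y i) (rnorm y).
  - exact: rnorm_ge0.
  - move=> s us; apply: le_trans (bessel dot_norm orthoE y us).
    apply: ler_sum => i _; rewrite rnormM exprMn ler_piMl ?sqr_ge0//.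
    by rewrite exprn_ile1 ?rnorm_ge0.
  by exists x.
have [K hK] := choice Kex.
have Klin : linear K.
  move=> c x y; apply: (fourier_inj dot_norm orthoE denseE) => i.
  by rewrite fourierD fourierZ !hK fourierD fourierZ mulrDr mulrCA.
pose KL : {linear H -> H} := HB.pack K (GRing.isLinear.Build _ _ _ _ K Klin).
exists 'i, KL; split.
  move=> x y; split=> [hxy|-> i /=].
    apply: (fourier_inj dot_norm orthoE denseE) => i; rewrite hK.
    have /= := hxy i; rewrite fourierD fourierZ => /(canRL (addrK _)).
    by rewrite -mulrBl => ->; rewrite mulKf.
  rewrite fourierD fourierZ !hK -{1}[coef y i](mulKf (k0 i)) -/(k i).
  by rewrite mulrCA -mulrDl subrK.
apply: precompact_totally_bounded => e e0.
have e20 : 0 < e / 2 by rewrite divr_gt0.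
(* outside s the multipliers k i are at most e / 2 *)
have /finite_seqP[s hs] := fin (2 / e); pose t := undup s.
have ut : uniq t by exact: undup_uniq.
have [L hL] := lin_comb_net t e20; exists L => _ [y /= + <-].
rewrite -[1]/(1%:C) rnorm_le => y1.
have [|p pL hp] := hL (fun i => k i * coef y i).
  move=> i; rewrite rnormM -[1]mulr1 ler_pM ?rnorm_ge0//.
  exact: le_trans (rnorm_fourier dot_norm orthoE _ _) y1.
exists p => //; apply: (le_lt_trans (rnorm_distD (comb t (fun i => k i * coef y i)) _ _)).
suff : rnorm (comb t (fun i => k i * coef y i) - K y) <= e / 2 by lra.
apply: (rnorm_le_of_fourier dot_norm orthoE denseE) => [|u uu]; first exact: ltW.
apply: (@le_trans _ _ (\sum_(i <- u) (e / 2) ^+ 2 * rnorm (coef y i) ^+ 2)).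
  apply: ler_sum => i _; rewrite fourierB fourier_lin_comb// hK.
  have [it|it] := boolP (i \in t).
    by rewrite subrr rnorm0 expr0n/= mulr_ge0 ?sqr_ge0.
  rewrite sub0r rnormN rnormM exprMn ler_wpM2r ?sqr_ge0//.
  rewrite -[e / 2]invrK invf_div lerXn2r ?nnegrE ?rnorm_ge0 ?invr_ge0 ?divr_ge0 ?(ltW e0)//.
  have di : 2 / e < `|d i|.
    rewrite ltNge; apply: contra it => di; rewrite mem_undup.
    by have : [set i | `|d i| <= 2 / e] i by []; rewrite hs.
  by apply: kle; [rewrite divr_gt0|right; lra].
rewrite -mulr_sumr ler_piMr ?sqr_ge0//.
apply: (le_trans (bessel dot_norm orthoE y uu)).
by rewrite exprn_ile1 ?rnorm_ge0.
Qed.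

End Resolvents.

(** * Weighted shifts *)

Section WeightedShifts.
Variables (R : realType) (H : completeNormedModType R[i]).
Variable dot : {dot H for Num.conj}.
Hypothesis dot_norm : hilbert_norm dot.
Variables (I : countType) (E : I -> H).
Hypothesis orthoE : forall i j, dot (E i) (E j) = (i == j)%:R.
Hypothesis denseE : forall x (e : R), 0 < e -> exists s c, rnorm (x - lin_comb E s c) < e.
Variable d : I -> R.

Variables (a : {linear H -> H}) (f g : I -> I) (p r : I -> R).
Hypothesis aE : forall i, a (E i) = (p i)%:C *: E (f i) + (r i)%:C *: E (g i).

Lemma bounded_commutator_shift (M : R) : 0 <= M -> continuous a ->
  injective f -> (forall i j, r i != 0 -> r j != 0 -> g i = g j -> i = j) ->
  (forall i, `|p i * (d (f i) - d i)| <= M) ->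
  (forall i, `|r i * (d (g i) - d i)| <= M) ->
  bounded_commutator (diag dot E d) a.
Proof.
move=> M0 /continuous_linear_rnorm_bound[A A0 aA] finj ginj pM rM.
have bound (w : I -> R) (h : I -> I) :
    (forall i j, w i != 0 -> w j != 0 -> h i = h j -> i = j) ->
    (forall i, `|w i| <= M) ->
    forall s c, uniq s ->
      rnorm (\sum_(i <- s) (c i * (w i)%:C) *: E (h i)) <= M * rnorm (lin_comb E s c).
  move=> hinj wM s c us.
  apply: ler_of_sqr; first by rewrite mulr_ge0 ?rnorm_ge0.
  rewrite (rnorm_reindexed_comb dot_norm orthoE)//; last first.
    move=> i j _ _; rewrite !mulf_eq0 !negb_or => /andP[_ wi] /andP[_ wj].
    by apply: hinj; [move: wi|move: wj]; apply: contraNneq => ->.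
  rewrite exprMn (rnorm_lin_comb dot_norm orthoE)// mulr_sumr.
  apply: ler_sum => i _; rewrite rnormM rnormc exprMn mulrC.
  rewrite ler_wpM2r ?sqr_ge0//.
  by have := wM i; have := normr_ge0 (w i); nra.
pose C i : H := (p i * (d (f i) - d i))%:C *: E (f i)
              + (r i * (d (g i) - d i))%:C *: E (g i).
apply: (@bounded_commutator_of_basis _ _ _ dot_norm _ _ orthoE denseE d a A (M + M) C) => //.
- exact: addr_ge0.
- move=> i; rewrite aE /C scalerDr !scalerA addrACA -!scalerDl.
  have e (x y z : R) : x%:C * y%:C + (y * (z - x))%:C = y%:C * z%:C :> R[i].
    by rewrite -!rmorphM -rmorphD/=; congr (_%:C); ring.
  rewrite !e -!scalerA.
  by apply: diagD; apply: diagZ; exact: (diag_E orthoE).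
move=> s c us; under eq_bigr do rewrite scalerDr !scalerA.
rewrite big_split/= (le_trans (rnormD _ _))// mulrDl lerD//.
  by apply: bound => // i j _ _ /finj.
apply: bound => // i j; rewrite !mulf_eq0 !negb_or => /andP[ri _] /andP[rj _].
exact: ginj.
Qed.

(** As f i and g i differ, p i * (d (f i) - d i) is the whole coordinate along
    E (f i) of the commutator applied to E i. *)
Lemma shift_commutator_coefficients :
  bounded_commutator (diag dot E d) a -> (forall i, f i != g i) ->
  exists M : R, forall i, `|p i| * `|d (f i) - d i| <= M.
Proof.
move=> /(bounded_commutatorP dot_norm orthoE denseE)[M M0 hM] fg.
exists M => i; have [w hw wM] := hM _ _ (diag_E orthoE d i).
move: wM; rewrite (rnorm_E dot_norm orthoE) mulr1; apply: le_trans.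
rewrite -normrM -rnormc; apply: le_trans (rnorm_fourier dot_norm orthoE w (f i)).
have gf : (g i == f i) = false by rewrite eq_sym (negPf (fg i)).
have /= := hw (f i).
rewrite linearZ/= aE !(fourierD, fourierZ) !(fourierE orthoE) eqxx gf.
rewrite !mulr0 !mulr1 !addr0 addrC => /(canRL (addrK _)) ->.
by rewrite -!rmorphM -rmorphB/= mulrBr (mulrC (p i)) (mulrC (p i)).
Qed.

End WeightedShifts.

(** * Growth of the eigenvalues *)

Section Growth.
Variable R : realType.
Variable d : nat -> nat -> R.

(** Going back one diagonal step changes an antidiagonal increment by at most
    2 * M, and k such steps lead from (m, k) to the boundary. *)
Lemma growth_antidiag_of_boundary (M M' : R) :
  (forall m k, (k <= m)%N -> `|d m.+1 k.+1 - d m k| <= M) ->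
  (forall m, `|d m.+1 0 - d m 0| <= M') ->
  growth_antidiag d.
Proof.
move=> h h0.
have M0 : 0 <= M := le_trans (normr_ge0 _) (h 0%N 0%N isT).
have M'0 : 0 <= M' := le_trans (normr_ge0 _) (h0 0%N).
have key k m : (k <= m)%N -> `|d m.+1 k - d m k| <= M' + 2 * M * k%:R.
  elim: k m => [|k IH] [|m]// km; rewrite ?mulr0 ?addr0//.
  have := IH m km; have := h m.+1 k (leqW km); have := h m k km.
  rewrite -[k.+1%:R]natr1 mulrDr mulr1 !ler_norml.
  by move=> /andP[? ?] /andP[? ?] /andP[? ?]; apply/andP; split; lra.
exists (M' + 2 * M) => m k km; apply: (le_trans (key k m km)).
by rewrite -[k.+1%:R]natr1; have := ler0n R k; nra.
Qed.

Definition diverges : Prop := forall N : R, exists B : nat,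
  forall m k, (k <= m)%N -> (B < m)%N -> N < `|d m k|.

Lemma constant_sign (u : nat -> R) (M : R) :
  (forall n, `|u n.+1 - u n| <= M) -> (forall n, M < `|u n|) ->
  forall n, (0 < u n) = (0 < u 0%N).
Proof.
move=> h hu; elim=> [//|n <-]; have := hu n; have := hu n.+1; have := h n.
rewrite ler_norml => /andP[h1 h2].
have [un|un] := ltP 0 (u n); have [un1|un1] := ltP 0 (u n.+1) => //.
  by rewrite (ler0_norm un1) (gtr0_norm un); lra.
by rewrite (gtr0_norm un1) (ler0_norm un); lra.
Qed.

Lemma one_sided_of_sign (N : R) (X : set R) (b : bool) :
  (forall x, X x -> N < `|x| /\ (0 < x) = b) -> one_sided N X.
Proof.
case: b => h; [left|right] => x /h[] /=.
  by move=> + x0; rewrite (gtr0_norm x0).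
by move=> + /negbT; rewrite -leNgt => + x0; rewrite (ler0_norm x0) => ?; lra.
Qed.

(** For T the sign is first carried along a diagonal down to b = 0, then along
    the boundary k = 0, where the antidiagonal increments are at most M'. *)
Lemma sign_condition_of_diverges :
  growth_diag d -> growth_antidiag d -> diverges -> sign_condition d.
Proof.
move=> [M hM] [M' hM'] disc N N0.
have [B hB] := disc (N + M + `|M'|).
have M0 : 0 <= M := le_trans (normr_ge0 _) (hM 0%N 0%N isT).
have big m k : (k <= m)%N -> (B < m)%N -> [/\ N < `|d m k|, M < `|d m k| & `|M'| < `|d m k|].
  by move=> km Bm; have := hB m k km Bm; have := normr_ge0 M'; split; lra.
exists B.+1, B.+1; split => //.
  apply: (@one_sided_of_sign _ _ (0 < d B.+1 0)) => x [a [b [Ba ->]]].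
  have ab : (b <= b + a)%N := leq_addr _ _.
  split; first by case: (big (b + a)%N b) => //; lia.
  rewrite (@constant_sign (fun b => d (b + a) b) M) => [|n|n].
  - rewrite add0n; have -> : a = (B.+1 + (a - B.+1))%N by lia.
    rewrite (@constant_sign (fun n => d (B.+1 + n) 0) `|M'|) ?addn0// => n.
      rewrite addnS; apply: (le_trans (hM' _ _ _)) => //.
      by rewrite mulr1 ler_norm.
    by case: (big (B.+1 + n)%N 0%N) => //; lia.
  - by rewrite addSn; apply: hM; lia.
  - by case: (big (n + a)%N n) => //; lia.
move=> r _; apply: (@one_sided_of_sign _ _ (0 < d (B.+1 + r) B.+1)) => x [b [Bb ->]].
split; first by case: (big (b + r)%N b) => //; lia.
have -> : b = (B.+1 + (b - B.+1))%N by lia.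
rewrite (@constant_sign (fun n => d (B.+1 + n + r) (B.+1 + n)) M) ?addn0// => n.
  by rewrite addnS addSn; apply: hM; lia.
by case: (big (B.+1 + n + r)%N (B.+1 + n)%N) => //; lia.
Qed.

Lemma one_sided_norm (N : R) (X : set R) x : 0 <= N -> one_sided N X -> X x -> N < `|x|.
Proof.
move=> N0 [] h /h /= hx; first by apply: (lt_le_trans hx); exact: ler_norm.
by rewrite -normrN; apply: lt_le_trans (ler_norm _); lra.
Qed.

Lemma diverges_of_sign_condition : sign_condition d -> diverges.
Proof.
move=> h N; have [k [l [_ _ hT hS]]] := h _ (normr_ge0 N).
exists (k + l)%N => m b bm klm; apply: (le_lt_trans (ler_norm N)).
have e : m = (b + (m - b))%N by lia.
have [mbk|kmb] := leqP (m - b) k.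
  by apply: one_sided_norm (hS _ mbk) _ => //; exists b; rewrite -e; split => //; lia.
by apply: one_sided_norm hT _ => //; exists (m - b)%N, b; rewrite -e.
Qed.

End Growth.

(** * Bounds on the weights of the generators *)

Section Coefficients.
Variables (R : realType) (q : R).
Hypotheses (q_gt0 : 0 < q) (q_lt1 : q < 1).

Let C := (1 - q ^+ 2)^-1.

Lemma expr_even_le n : (0 < n)%N -> q ^+ (2 * n) <= q ^+ 2.
Proof. by case: n => // n _; rewrite mulnS exprD ler_piMr ?sqr_ge0 ?exprn_ile1// ltW. Qed.

Lemma sqr_q_lt1 : q ^+ 2 < 1.
Proof. by rewrite exprn_ilt1// ltW. Qed.

Lemma one_minus_itv n : 0 <= 1 - q ^+ n <= 1.
Proof. by rewrite subr_ge0 exprn_ile1 ?(ltW q_gt0) ?(ltW q_lt1)// gerBl exprn_ge0// ltW. Qed.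

Lemma C_gt0 : 0 < C.
Proof. by rewrite invr_gt0 subr_gt0 sqr_q_lt1. Qed.

Lemma ratio_le (x y : R) n : 0 <= x <= 1 -> 0 <= y <= 1 -> (0 < n)%N ->
  0 <= x * y / ((1 - q ^+ (2 * n)) * (1 - q ^+ (2 * n + 2))) <= C ^+ 2.
Proof.
move=> /andP[x0 x1] /andP[y0 y1] n0.
have h1 := expr_even_le n0.
have h2 : q ^+ (2 * n + 2) <= q ^+ 2 by rewrite -(mulnDr 2 n 1); apply: expr_even_le; lia.
have q2 := sqr_q_lt1.
have p0 : 0 < (1 - q ^+ 2) ^+ 2 by rewrite exprn_gt0// subr_gt0.
have p1 : (1 - q ^+ 2) ^+ 2 <= (1 - q ^+ (2 * n)) * (1 - q ^+ (2 * n + 2)).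
  by rewrite [leLHS]expr2; apply: ler_pM; lra.
move: p1; set P := (1 - q ^+ (2 * n)) * _ => p1.
have P0 : 0 < P := lt_le_trans p0 p1.
apply/andP; split; first by rewrite divr_ge0 ?(ltW P0)// mulr_ge0.
rewrite -[leRHS]mul1r /C exprVn; apply: ler_pM; rewrite ?invr_ge0 ?(ltW P0) ?mulr_ge0//.
  by rewrite -[leRHS]mulr1; apply: ler_pM.
by rewrite lef_pV2 ?posrE.
Qed.

Lemma sqrt_le (x y : R) : 0 <= y -> x <= y ^+ 2 -> Num.sqrt x <= y.
Proof. by move=> y0 xy; rewrite -(ger0_norm y0) -sqrtr_sqr ler_wsqrtr. Qed.

Lemma sqrt_ratio_le (w x y v : R) n : 0 <= v -> 0 <= w <= v ^+ 2 ->
  0 <= x <= 1 -> 0 <= y <= 1 -> (0 < n)%N ->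
  Num.sqrt (w * (x * y / ((1 - q ^+ (2 * n)) * (1 - q ^+ (2 * n + 2))))) <= v * C.
Proof.
move=> v0 /andP[w0 wv] hx hy n0; have /andP[r0 r1] := ratio_le hx hy n0.
apply: sqrt_le; first by rewrite mulr_ge0// ltW// C_gt0.
by rewrite exprMn ler_pM.
Qed.

Lemma a_minus_support m k l : a_minus q m k l != 0 -> (0 < k)%N /\ (0 < l)%N.
Proof.
move=> h; split; rewrite lt0n; apply: contra h => /eqP ->;
  by rewrite /a_minus muln0 expr0 subrr !(mul0r, mulr0) sqrtr0.
Qed.

Lemma b_minus_support m k l : b_minus q m k l != 0 -> (k < m)%N /\ (0 < l)%N.
Proof.
move=> h; split; last first.
  rewrite lt0n; apply: contra h => /eqP ->.
  by rewrite /b_minus muln0 expr0 subrr !(mul0r, mulr0) sqrtr0.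
rewrite ltnNge; apply: contra h => h; rewrite /b_minus (eqP h).
by rewrite muln0 expr0 subrr !(mulr0, mul0r) sqrtr0.
Qed.

Lemma a_plus_le m k l : `|a_plus q m k l| <= q ^+ k * C.
Proof.
rewrite ger0_norm ?sqrtr_ge0// /a_plus.
have -> : (2 * m + 4 = 2 * m.+1 + 2)%N by lia.
have -> : (2 * m + 2 = 2 * m.+1)%N by lia.
apply: sqrt_ratio_le; rewrite ?one_minus_itv// ?exprn_ge0 ?(ltW q_gt0)//=.
rewrite -exprM -addnA exprD mulnC ler_piMr// ?exprn_ge0 ?(ltW q_gt0)//.
by rewrite exprn_ile1// ltW.
Qed.

Lemma b_plus_le m k l : `|b_plus q m k l| <= C.
Proof.
rewrite normrN ger0_norm ?sqrtr_ge0//.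
have -> : (2 * m + 4 = 2 * m.+1 + 2)%N by lia.
have -> : (2 * m + 2 = 2 * m.+1)%N by lia.
rewrite -[C]mul1r; apply: sqrt_ratio_le; rewrite ?one_minus_itv//.
by rewrite expr1n exprn_ge0 ?(ltW q_gt0)//= exprn_ile1// ltW.
Qed.

Lemma a_minus_le m k l : (k <= m)%N -> `|a_minus q m k l| <= C.
Proof.
move=> km; rewrite ger0_norm ?sqrtr_ge0//.
have C0 := C_gt0.
(* at m = 0 the denominator vanishes and so does the numerator *)
have [m0|m0] := posnP m.
  have -> : k = 0%N by lia.
  by rewrite /a_minus muln0 expr0 subrr mulr0 mul0r sqrtr0 ltW.
rewrite /a_minus -[X in Num.sqrt X]mul1r -[C]mul1r.
by apply: sqrt_ratio_le; rewrite ?one_minus_itv// expr1n ler01 lexx.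
Qed.

Lemma b_minus_le m k l : (k <= m)%N -> (l <= m)%N -> `|b_minus q m k l| <= q ^+ k * C.
Proof.
move=> km lm; rewrite ger0_norm ?sqrtr_ge0//.
have C0 := C_gt0; have [m0|m0] := posnP m.
  have -> : l = 0%N by lia.
  rewrite /b_minus muln0 expr0 subrr !(mul0r, mulr0) sqrtr0.
  by rewrite mulr_ge0 ?exprn_ge0// ltW.
apply: sqrt_ratio_le; rewrite ?one_minus_itv// ?exprn_ge0 ?(ltW q_gt0)//=.
by rewrite -exprM mulnC.
Qed.

(** (k + 1) q^k is at most the partial sum 1 + q + ... + q^k of the geometric
    series. *)
Lemma succ_expr_le k : q ^+ k * k.+1%:R <= (1 - q)^-1.
Proof.
have q1 : 0 < 1 - q by rewrite subr_gt0.
rewrite -[leRHS]mul1r ler_pdivlMr//.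
have key : q ^+ k * k.+1%:R * (1 - q) <= 1 - q ^+ k.+1.
  elim: k => [|k IH]; first by rewrite expr0 expr1 !mul1r.
  rewrite -[k.+2%:R]natr1 !exprS; rewrite exprS in IH.
  have : q * (q ^+ k * k.+1%:R * (1 - q)) <= q ^+ k * k.+1%:R * (1 - q).
    rewrite ler_piMl ?(ltW q_lt1)// !mulr_ge0 ?(ltW q1) ?ler0n//.
    by rewrite exprn_ge0 ?(ltW q_gt0).
  by nra.
by apply: (le_trans key); rewrite gerBl exprn_ge0// ltW.
Qed.

Lemma boundary_ratio n : (0 < n)%N ->
  1 - q ^+ 2 <= (1 - q ^+ (2 * n)) / (1 - q ^+ (2 * n + 2)).
Proof.
move=> n0; have h1 := expr_even_le n0.
have h2 : 0 <= q ^+ (2 * n + 2) by rewrite exprn_ge0// ltW.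
have h3 : q ^+ (2 * n + 2) <= q ^+ 2 by rewrite -(mulnDr 2 n 1); apply: expr_even_le; lia.
by have q2 := sqr_q_lt1; rewrite ler_pdivlMr; nra.
Qed.

Lemma a_plus_boundary m : q * Num.sqrt (1 - q ^+ 2) <= `|a_plus q m 0 0|.
Proof.
have q2 := sqr_q_lt1.
rewrite ger0_norm ?sqrtr_ge0// -[X in X * _](ger0_norm (ltW q_gt0)) -sqrtr_sqr.
rewrite -sqrtrM ?sqr_ge0// ler_wsqrtr// !muln0 !add0n subn0.
have -> : (2 * m + 4 = 2 * m.+1 + 2)%N by lia.
have -> : (2 * m + 2 = 2 * m.+1)%N by lia.
rewrite ler_wpM2l ?sqr_ge0// -mulf_div divff ?mul1r ?boundary_ratio//.
by rewrite gt_eqF// subr_gt0 (le_lt_trans (expr_even_le _)).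
Qed.

Lemma b_plus_boundary m k : (k <= m)%N -> Num.sqrt (1 - q ^+ 2) <= `|b_plus q m k 0|.
Proof.
move=> km; have q2 := sqr_q_lt1.
rewrite normrN ger0_norm ?sqrtr_ge0// ler_wsqrtr// muln0 expr0 mul1r subn0.
have -> : (2 * m + 4 = 2 * m.+1 + 2)%N by lia.
have -> : (2 * m + 2 = 2 * m.+1)%N by lia.
have -> : (2 * k + 2 = 2 * k.+1)%N by lia.
rewrite -mulf_div divff ?mul1r; last first.
  by rewrite gt_eqF// subr_gt0 (le_lt_trans (expr_even_le _)).
have hk := @expr_even_le k.+1 isT.
have hm : 0 < 1 - q ^+ (2 * m.+1 + 2).
  by rewrite subr_gt0 -(mulnDr 2 _ 1) (le_lt_trans (expr_even_le _))// addn1.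
have hm1 : 0 <= q ^+ (2 * m.+1 + 2) by rewrite exprn_ge0// ltW.
by rewrite ler_pdivlMr//; nra.
Qed.

End Coefficients.

(** * The basis of matrix entries *)

(** The admissible triples (m, k, l) form a type of their own, so that the
    basis vectors become an orthonormal family without side conditions. *)
Definition entry_index :=
  {t : nat * nat * nat | (t.1.2 <= t.1.1)%N && (t.2 <= t.1.1)%N}.

Section HaarBasis.
Variables (R : realType) (H : completeNormedModType R[i]).
Variable dot : {dot H for Num.conj}.
Hypothesis dot_norm : hilbert_norm dot.
Variable e : nat -> nat -> nat -> H.
Hypothesis e_basis : orthonormal_basis dot e.

Definition matrix_entry (i : entry_index) : H := e (val i).1.1 (val i).1.2 (val i).2.

Local Notation E := matrix_entry.

Lemma entry_index_exists m k l : (k <= m)%N -> (l <= m)%N ->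
  exists i : entry_index, val i = (m, k, l).
Proof.
move=> km lm; have h : ((m, k, l).1.2 <= (m, k, l).1.1)%N && ((m, k, l).2 <= (m, k, l).1.1)%N.
  by rewrite /= km.
by exists (exist _ (m, k, l) h).
Qed.

Lemma matrix_entry_ortho i j : dot (E i) (E j) = (i == j)%:R.
Proof.
case: e_basis => eE _; have /andP[? ?] := valP i; have /andP[? ?] := valP j.
by rewrite /matrix_entry eE// -val_eqE -!pair_eqE /pair_eq -andbA.
Qed.

Lemma fin_comb_finite_expansion N c : finite_expansion dot E (fin_comb N c e).
Proof.
rewrite /fin_comb.
apply: (finite_expansion_sum dot_norm matrix_entry_ortho) => m.
apply: (finite_expansion_sum dot_norm matrix_entry_ortho) => k.
apply: (finite_expansion_sum dot_norm matrix_entry_ortho) => l.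
have [i iE] := @entry_index_exists m k l (ltn_ord k) (ltn_ord l).
have -> : e m k l = E i by rewrite /matrix_entry iE.
rewrite -[_ *: _]addr0; apply: (finite_expansionP dot_norm matrix_entry_ortho).
  exact: finite_expansion_E matrix_entry_ortho i.
by exists [::] => //; rewrite /fourier_sum /lin_comb big_nil.
Qed.

Lemma matrix_entry_dense x (r : R) : 0 < r -> exists s c, rnorm (x - lin_comb E s c) < r.
Proof.
move=> r0; case: e_basis => _ de.
have [|y [yx [N [c yE]]]] := de (ball x r%:C)° _ (open_interior _).
  by exists x; apply: nbhsx_ballx; rewrite ltcR.
have [s _ ys] := fin_comb_finite_expansion N c.
exists s, (fourier dot E y); rewrite -/(fourier_sum dot E s y).
have := interior_subset yx; rewrite -ball_normE /ball_/= rnorm_lt.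
by rewrite {1}yE ys -yE.
Qed.

Lemma diagonal_operatorE (d : nat -> nat -> R) :
  diagonal_operator dot e d = diag dot E (fun i => d (val i).1.1 (val i).1.2).
Proof.
apply/seteqP; split=> p h => [i|m k l km lm].
  by case/andP: (valP i) => ? ?; exact: h.
by have [i iE] := entry_index_exists km lm; have := h i; rewrite /fourier /matrix_entry iE.
Qed.

Section Commutation.
Variable d : nat -> nat -> R.
Local Notation D := (diagonal_operator dot e d).

Lemma diag_fin_comb N c (v : nat -> nat -> nat -> H) :
  (forall m k l, (k <= m)%N -> (l <= m)%N -> D (v m k l, (d m k)%:C *: v m k l)) ->
  D (fin_comb N c v, fin_comb N (fun m k l => (d m k)%:C * c m k l) v).
Proof.
rewrite diagonal_operatorE => h; rewrite /fin_comb.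
apply: diag_sum => m; apply: diag_sum => k; apply: diag_sum => l.
rewrite mulrC -scalerA; apply: diagZ.
exact: (h m k l (ltn_ord k) (ltn_ord l)).
Qed.

Lemma diag_e m k l : (k <= m)%N -> (l <= m)%N -> D (e m k l, (d m k)%:C *: e m k l).
Proof.
move=> km lm; rewrite diagonal_operatorE; have [i iE] := entry_index_exists km lm.
by have := diag_E matrix_entry_ortho (fun i => d (val i).1.1 (val i).1.2) i; rewrite /matrix_entry iE.
Qed.

(** D commutes with any operator on the span that preserves the first two
    indices of the basis, as d does not depend on the third. *)
Lemma diagonal_commutes (T : set (H * H)) (v : nat -> nat -> nat -> H) :
  (forall N c, T (fin_comb N c e, fin_comb N c v)) ->
  (forall m k l, (k <= m)%N -> (l <= m)%N -> D (v m k l, (d m k)%:C *: v m k l)) ->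
  commutes e D T.
Proof.
move=> hT hv x [N [c ->]].
exists (fin_comb N (fun m k l => (d m k)%:C * c m k l) e), (fin_comb N c v),
  (fin_comb N (fun m k l => (d m k)%:C * c m k l) v); split => //.
  by apply: diag_fin_comb => m k l; exact: diag_e.
exact: diag_fin_comb.
Qed.

Lemma diag_scale_e (r : R[i]) m k l l' : (k <= m)%N -> (l' <= m)%N ->
  l = l' -> D (r *: e m k l, (d m k)%:C *: (r *: e m k l)).
Proof.
move=> km lm ->; rewrite scalerA mulrC -scalerA.
by have := diag_e km lm; rewrite diagonal_operatorE; exact: diagZ.
Qed.

Lemma diag_00 : D (0, 0).
Proof. by rewrite diagonal_operatorE; exact: diag0. Qed.

Variable q : R.

Lemma diagonal_commutes_A0 : commutes e D (A0 e q).
Proof.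
apply: diagonal_commutes => [N c|m k l km lm /=]; first by exists N, c.
exact: diag_scale_e km lm erefl.
Qed.

Lemma diagonal_commutes_A1 : commutes e D (A1 e q).
Proof.
apply: diagonal_commutes => [N c|m k l km lm /=]; first by exists N, c.
rewrite /=; case: ifP => lm'; last by rewrite scaler0; exact: diag_00.
exact: diag_scale_e km lm' erefl.
Qed.

Definition raising_coef (m l : nat) : R :=
  let n := Defs.half R m in let j := l%:R - n in
  Num.sqrt (q `^ (- 2 * n) + q `^ (2 * n + 2)
            - q `^ (- 2 * j) - q `^ (2 * j + 2)).

Lemma dot_fin_comb N N' c c' (v v' : nat -> nat -> nat -> H) :
  (forall m k l m' k' l', (k <= m)%N -> (l <= m)%N -> (k' <= m')%N -> (l' <= m')%N ->
     dot (v m k l) (e m' k' l') = dot (e m k l) (v' m' k' l')) ->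
  dot (fin_comb N c v) (fin_comb N' c' e) = dot (fin_comb N c e) (fin_comb N' c' v').
Proof.
move=> h; rewrite /fin_comb !dot_suml; apply: eq_bigr => m _.
rewrite !dot_suml; apply: eq_bigr => k _; rewrite !dot_suml; apply: eq_bigr => l _.
rewrite !dotZl; congr (_ * _).
rewrite !dot_sumr; apply: eq_bigr => m' _.
rewrite !dot_sumr; apply: eq_bigr => k' _; rewrite !dot_sumr; apply: eq_bigr => l' _.
by rewrite !dotZr (h m k l m' k' l' (ltn_ord k) (ltn_ord l) (ltn_ord k') (ltn_ord l')).
Qed.

(** The operator on the span given by the lowering vectors v below is a
    restriction of the adjoint of A1. *)
Lemma diagonal_commutes_adjoint_A1 : commutes e D (adjoint dot (A1 e q)).
Proof.
pose v m k l := if l is l'.+1 then (raising_coef m l')%:C *: e m k l' else 0.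
apply: (@diagonal_commutes _ v) => [N c|m k [|l] km lm /=].
- move=> _ _ [N' [c' [-> ->]]]; apply: dot_fin_comb => m k l m' k' l' km lm km' lm' /=.
  have eE := e_basis.1.
  case: ifP => ltlm.
    rewrite dotZl; case: l' lm' => [|l'] lm' /=.
      by rewrite dot0r eE//= !andbF mulr0.
    rewrite dotZr conj_real !eE ?(ltnW lm')//= eqSS.
    by case: (m =P m') => [->|_]; case: (k == k'); case: (l =P l') => [->|_]//=;
      rewrite ?mulr0 ?mulr1.
  rewrite dot0l; case: l' lm' => [|l'] lm' /=; first by rewrite dot0r.
  rewrite dotZr eE ?(ltnW lm')//.
  by case: (m =P m') => [?|_]; case: (k == k'); case: (l =P l') => [?|_]//=;
      rewrite ?mulr0//; lia.
- by rewrite scaler0; exact: diag_00.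
exact: diag_scale_e km (ltnW lm) erefl.
Qed.

Lemma diagonal_equivariant : equivariant dot e q D.
Proof.
split; [exact: diagonal_commutes_A0|exact: diagonal_commutes_A1
  |exact: diagonal_commutes_adjoint_A1|by exists d].
Qed.

End Commutation.

Lemma diverges_of_finite (d : nat -> nat -> R) :
  (forall N : R, finite_set [set i : entry_index | `|d (val i).1.1 (val i).1.2| <= N]) ->
  diverges d.
Proof.
move=> fin N; have /finite_seqP[s hs] := fin N.
exists (\max_(i <- s) (val i).1.1) => m k km; apply: contraTT; rewrite -leNgt -leqNgt => dN.
have [i iE] := entry_index_exists km (leq0n m).
have iS : i \in s.
  have : [set i : entry_index | `|d (val i).1.1 (val i).1.2| <= N] i by rewrite /= iE.
  by rewrite hs.
have -> : m = (val i).1.1 by rewrite iE.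
exact: (leq_bigmax_seq (F := fun i : entry_index => (val i).1.1)).
Qed.

Lemma finite_of_diverges (d : nat -> nat -> R) : diverges d ->
  forall N : R, finite_set [set i : entry_index | `|d (val i).1.1 (val i).1.2| <= N].
Proof.
move=> disc N; have [B hB] := disc N.
have fin : finite_set [set t : nat * nat * nat | [&& t.1.1 < B.+1, t.1.2 < B.+1 & t.2 < B.+1]%N].
  have := finite_setX (finite_setX (finite_II B.+1) (finite_II B.+1)) (finite_II B.+1).
  by apply: sub_finite_set => -[[m k] l] /= /and3P[].
apply: sub_finite_set (finite_preimage (f := val) _ fin).
  move=> i /= dN; case/andP: (valP i) => km lm.
  have mB : ((val i).1.1 <= B)%N.
    by rewrite leqNgt; apply/negP => Bm; have := hB _ _ km Bm; rewrite ltNge dN.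
  by rewrite !ltnS mB !(leq_trans _ mB).
by move=> i j _ _; exact: val_inj.
Qed.

End HaarBasis.

(** * The generators as weighted shifts *)

Section IndexShifts.

(** Only [beta_down] can leave the admissible range, when k = m; the default
    value i is then harmless because the weight b_- vanishes. *)
Definition index_shift (F : nat * nat * nat -> nat * nat * nat)
    (i : entry_index) : entry_index :=
  insubd i (F (val i)).

Lemma val_index_shift F i :
  ((F (val i)).1.2 <= (F (val i)).1.1)%N && ((F (val i)).2 <= (F (val i)).1.1)%N ->
  val (index_shift F i) = F (val i).
Proof. by move=> h; rewrite val_insubd h. Qed.

Definition alpha_up (t : nat * nat * nat) := (t.1.1.+1, t.1.2, t.2).
Definition alpha_down (t : nat * nat * nat) := (t.1.1.-1, t.1.2.-1, t.2.-1).
Definition beta_up (t : nat * nat * nat) := (t.1.1.+1, t.1.2.+1, t.2).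
Definition beta_down (t : nat * nat * nat) := (t.1.1.-1, t.1.2, t.2.-1).

Lemma entry_index_le (i : entry_index) :
  ((val i).1.2 <= (val i).1.1)%N /\ ((val i).2 <= (val i).1.1)%N.
Proof. by case/andP: (valP i). Qed.

Lemma alpha_up_inj : injective alpha_up.
Proof. by move=> [[m k] l] [[m' k'] l'] [-> -> ->]. Qed.

Lemma beta_up_inj : injective beta_up.
Proof. by move=> [[m k] l] [[m' k'] l'] [-> -> ->]. Qed.

Lemma alpha_down_inj t t' : (0 < t.1.1)%N -> (0 < t.1.2)%N -> (0 < t.2)%N ->
  (0 < t'.1.1)%N -> (0 < t'.1.2)%N -> (0 < t'.2)%N ->
  alpha_down t = alpha_down t' -> t = t'.
Proof.
by move: t t' => [[[|m] [|k]] [|l]] // [[[|m'] [|k']] [|l']] //= _ _ _ _ _ _ [-> -> ->].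
Qed.

Lemma beta_down_inj t t' : (0 < t.1.1)%N -> (0 < t.2)%N ->
  (0 < t'.1.1)%N -> (0 < t'.2)%N -> beta_down t = beta_down t' -> t = t'.
Proof.
by move: t t' => [[[|m] k] [|l]] // [[[|m'] k'] [|l']] //= _ _ _ _ [-> -> ->].
Qed.

Lemma val_alpha_up i : val (index_shift alpha_up i) = alpha_up (val i).
Proof.
have h := entry_index_le i; rewrite val_index_shift// /alpha_up.
by move: h; case: (val i) => [[m k] l] /= [? ?]; apply/andP; split; lia.
Qed.

Lemma val_alpha_down i : val (index_shift alpha_down i) = alpha_down (val i).
Proof.
have h := entry_index_le i; rewrite val_index_shift// /alpha_down.
by move: h; case: (val i) => [[m k] l] /= [? ?]; apply/andP; split; lia.
Qed.

Lemma val_beta_up i : val (index_shift beta_up i) = beta_up (val i).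
Proof.
have h := entry_index_le i; rewrite val_index_shift// /beta_up.
by move: h; case: (val i) => [[m k] l] /= [? ?]; apply/andP; split; lia.
Qed.

Lemma val_beta_down i : ((val i).1.2 < (val i).1.1)%N ->
  val (index_shift beta_down i) = beta_down (val i).
Proof.
have h := entry_index_le i => km; rewrite val_index_shift// /beta_down.
by move: h km; case: (val i) => [[m k] l] /= [? ?] ?; apply/andP; split; lia.
Qed.

End IndexShifts.

Section Generators.
Variables (R : realType) (q : R).
Hypotheses (q_gt0 : 0 < q) (q_lt1 : q < 1).
Variable (H : completeNormedModType R[i]) (dot : {dot H for Num.conj}).
Hypothesis dot_norm : hilbert_norm dot.
Variable e : nat -> nat -> nat -> H.
Hypothesis e_basis : orthonormal_basis dot e.
Variables alpha beta : {linear H -> H}.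
Hypothesis action : SUq2_action e q alpha beta.

Local Notation E := (matrix_entry e).
Local Notation orthoE := (matrix_entry_ortho e_basis).
Local Notation denseE := (matrix_entry_dense dot_norm e_basis).

Definition coef_at (c : nat -> nat -> nat -> R) (i : entry_index) : R :=
  c (val i).1.1 (val i).1.2 (val i).2.

Lemma alpha_E i : alpha (E i) =
  (coef_at (a_plus q) i)%:C *: E (index_shift alpha_up i)
  + (coef_at (a_minus q) i)%:C *: E (index_shift alpha_down i).
Proof.
case: action => _ _ aE _; have [km lm] := entry_index_le i.
by rewrite /matrix_entry val_alpha_up val_alpha_down aE.
Qed.

Lemma beta_E i : beta (E i) =
  (coef_at (b_plus q) i)%:C *: E (index_shift beta_up i)
  + (coef_at (b_minus q) i)%:C *: E (index_shift beta_down i).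
Proof.
case: action => _ _ _ bE; have [km lm] := entry_index_le i.
rewrite [in LHS]/matrix_entry bE// [in RHS]/matrix_entry val_beta_up.
rewrite /coef_at; have [->|] := eqVneq (b_minus q (val i).1.1 (val i).1.2 (val i).2) 0.
  by rewrite !scale0r.
by move=> /b_minus_support[km' _]; rewrite /matrix_entry val_beta_down.
Qed.

Variable d : nat -> nat -> R.
Let dI (i : entry_index) : R := d (val i).1.1 (val i).1.2.
Local Notation D := (diag dot E dI).

Section Sufficiency.
Variables M1 M2 : R.
Hypothesis diag_le : forall m k, (k <= m)%N -> `|d m.+1 k.+1 - d m k| <= M1.
Hypothesis antidiag_le : forall m k, (k <= m)%N -> `|d m.+1 k - d m k| <= M2 * k.+1%:R.

Let C := (1 - q ^+ 2)^-1.
Let M := C * M1 + C * (1 - q)^-1 * M2.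

Let C0 : 0 <= C. Proof. exact/ltW/C_gt0. Qed.

Let M1_ge0 : 0 <= M1.
Proof. exact: le_trans (normr_ge0 _) (diag_le (leqnn 0)). Qed.

Let M2_ge0 : 0 <= M2.
Proof. by have := le_trans (normr_ge0 _) (antidiag_le (leqnn 0)); rewrite mulr1. Qed.

Let M_ge0 : 0 <= M.
Proof. by rewrite addr_ge0 ?mulr_ge0// invr_ge0 subr_ge0 ltW. Qed.

Lemma bounded_times_diag (c x : R) : `|c| <= C -> `|x| <= M1 -> `|c * x| <= M.
Proof.
move=> hc hx; rewrite normrM; apply: (@le_trans _ _ (C * M1)); first exact: ler_pM.
by rewrite lerDl !mulr_ge0// invr_ge0 subr_ge0 ltW.
Qed.

Lemma decaying_times_antidiag (c x : R) k :
  `|c| <= q ^+ k * C -> `|x| <= M2 * k.+1%:R -> `|c * x| <= M.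
Proof.
move=> hc hx; rewrite normrM; apply: (@le_trans _ _ (C * (1 - q)^-1 * M2)); last first.
  by rewrite lerDr mulr_ge0.
apply: (@le_trans _ _ ((q ^+ k * C) * (M2 * k.+1%:R))); first exact: ler_pM.
have -> : q ^+ k * C * (M2 * k.+1%:R) = C * (q ^+ k * k.+1%:R) * M2 by ring.
by rewrite ler_wpM2r// ler_wpM2l// succ_expr_le.
Qed.

Lemma bounded_commutator_alpha : bounded_commutator D alpha.
Proof.
case: action => ac _ _ _.
apply: (bounded_commutator_shift dot_norm orthoE denseE alpha_E M_ge0 ac).
- move=> i j /(congr1 val); rewrite !val_alpha_up => /alpha_up_inj.
  exact: val_inj.
- move=> i j /a_minus_support[ki li] /a_minus_support[kj lj] /(congr1 val).
  have [mi _] := entry_index_le i; have [mj _] := entry_index_le j.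
  rewrite !val_alpha_down => h; apply/val_inj/(alpha_down_inj _ _ _ _ _ _ h) => //.
    exact: leq_trans ki mi.
  exact: leq_trans kj mj.
- move=> i; have [km lm] := entry_index_le i.
  apply: decaying_times_antidiag; first exact: a_plus_le.
  by rewrite /dI val_alpha_up /=; apply: antidiag_le.
move=> i; have [km lm] := entry_index_le i.
have [->|/a_minus_support[k0 l0]] := eqVneq (coef_at (a_minus q) i) 0.
  by rewrite mul0r normr0.
apply: bounded_times_diag; first exact: a_minus_le.
rewrite /dI val_alpha_down /alpha_down/= distrC.
have := @diag_le (val i).1.1.-1 (val i).1.2.-1.
by rewrite !prednK ?(leq_trans k0 km)//; apply; rewrite -!subn1 leq_sub2r.
Qed.

Lemma bounded_commutator_beta : bounded_commutator D beta.
Proof.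
case: action => _ bc _ _.
apply: (bounded_commutator_shift dot_norm orthoE denseE beta_E M_ge0 bc).
- move=> i j /(congr1 val); rewrite !val_beta_up => /beta_up_inj.
  exact: val_inj.
- move=> i j /b_minus_support[ki li] /b_minus_support[kj lj] /(congr1 val).
  rewrite !val_beta_down// => h; apply/val_inj/(beta_down_inj _ _ _ _ h) => //.
    exact: leq_ltn_trans ki.
  exact: leq_ltn_trans kj.
- move=> i; have [km lm] := entry_index_le i.
  apply: bounded_times_diag; first exact: b_plus_le.
  by rewrite /dI val_beta_up /=; apply: diag_le.
move=> i; have [km lm] := entry_index_le i.
have [->|/b_minus_support[k0 l0]] := eqVneq (coef_at (b_minus q) i) 0.
  by rewrite mul0r normr0.
apply: (@decaying_times_antidiag _ _ (val i).1.2); first exact: b_minus_le.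
rewrite /dI val_beta_down// /beta_down/= distrC.
have := @antidiag_le (val i).1.1.-1 (val i).1.2.
have m0 : (0 < (val i).1.1)%N by exact: leq_ltn_trans k0.
by rewrite prednK//; apply; rewrite -ltnS prednK.
Qed.

End Sufficiency.

Lemma spectral_triple_of_growth :
  growth_diag d -> growth_antidiag d -> sign_condition d ->
  odd_spectral_triple dot (SUq2_Af dot alpha beta) D.
Proof.
move=> [M1 h1] [M2 h2] /diverges_of_sign_condition disc; split.
- exact: (diag_self_adjoint dot_norm orthoE denseE).
- exact: (compact_resolvent_of_finite dot_norm orthoE denseE (finite_of_diverges disc)).
move=> a Aa; apply/(bounded_commutatorP dot_norm orthoE denseE).
suff [_ _ //] : almost_commuting dot E dI a.
apply: (star_algebra_almost_commuting dot_norm orthoE denseE _ Aa) => _ [->|->].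
  split; first exact: linearP.
    by case: action => /continuous_linear_rnorm_bound.
  apply/(bounded_commutatorP dot_norm orthoE denseE).
  exact: bounded_commutator_alpha h1 h2.
split; first exact: linearP.
  by case: action => _ /continuous_linear_rnorm_bound.
apply/(bounded_commutatorP dot_norm orthoE denseE).
exact: bounded_commutator_beta h1 h2.
Qed.

Lemma growth_of_spectral_triple :
  odd_spectral_triple dot (SUq2_Af dot alpha beta) D ->
  [/\ growth_diag d, growth_antidiag d & sign_condition d].
Proof.
move=> [_ CR BC].
have s0 : 0 < Num.sqrt (1 - q ^+ 2) by rewrite sqrtr_gt0 subr_gt0 sqr_q_lt1.
have [Ma hMa] : exists M : R, forall i,
    `|coef_at (a_plus q) i| * `|dI (index_shift alpha_up i) - dI i| <= M.
  apply: (shift_commutator_coefficients dot_norm orthoE denseE alpha_E) => [|i].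
    by apply: BC; apply: star_gen; left.
  by apply/eqP => /(congr1 val); rewrite val_alpha_up val_alpha_down => -[] h _ _; lia.
have [Mb hMb] : exists M : R, forall i,
    `|coef_at (b_plus q) i| * `|dI (index_shift beta_up i) - dI i| <= M.
  apply: (shift_commutator_coefficients dot_norm orthoE denseE beta_E) => [|i].
    by apply: BC; apply: star_gen; right.
  apply/eqP => /(congr1 val); rewrite val_beta_up.
  have [h|h] := ltnP (val i).1.2 (val i).1.1.
    by rewrite val_beta_down// => -[] h'; lia.
  rewrite val_insubd; case: ifP => _; last by case: (val i) => [[? ?] ?] []; lia.
  by case=> h'; lia.
have hd : forall m k, (k <= m)%N -> `|d m.+1 k.+1 - d m k| <= Mb / Num.sqrt (1 - q ^+ 2).
  move=> m k km; have [i iE] := entry_index_exists km (leq0n m).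
  have := hMb i; rewrite /dI val_beta_up /coef_at iE /= => h.
  rewrite ler_pdivlMr// mulrC; apply: le_trans h.
  by rewrite ler_wpM2r// b_plus_boundary.
have ha m : `|d m.+1 0 - d m 0| <= Ma / (q * Num.sqrt (1 - q ^+ 2)).
  have [i iE] := entry_index_exists (leq0n m) (leq0n m).
  have := hMa i; rewrite /dI val_alpha_up /coef_at iE /= => h.
  rewrite ler_pdivlMr ?mulr_gt0// mulrC; apply: le_trans h.
  by rewrite ler_wpM2r// a_plus_boundary.
have gd : growth_diag d by exists (Mb / Num.sqrt (1 - q ^+ 2)).
have ga := growth_antidiag_of_boundary hd ha.
split=> //; apply: sign_condition_of_diverges => //.
apply: diverges_of_finite => N.
exact: (finite_of_compact_resolvent dot_norm orthoE N CR).
Qed.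

End Generators.

(** * The characterization *)

Theorem theorem3p4 (R : realType) (q : R) (q_gt0 : 0 < q) (q_lt1 : q < 1)
    (H : completeNormedModType R[i]) (dot : {dot H for Num.conj})
    (dot_norm : hilbert_norm dot)
    (e : nat -> nat -> nat -> H) (e_basis : orthonormal_basis dot e)
    (alpha beta : {linear H -> H}) (action : SUq2_action e q alpha beta)
    (D : set (H * H)) (D_operator : is_operator D) :
  equivariant_spectral_triple dot e q alpha beta D <->
  exists d : nat -> nat -> R,
    [/\ D = diagonal_operator dot e d,
        growth_diag d, growth_antidiag d & sign_condition d].
Proof.
split=> [[triple [_ _ _ [d DE]]]|[d [-> gd ga sc]]].
  exists d; rewrite DE diagonal_operatorE in triple.
  by have [] := growth_of_spectral_triple q_gt0 q_lt1 dot_norm e_basis action triple.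
split; last exact: diagonal_equivariant.
rewrite diagonal_operatorE.
exact: (spectral_triple_of_growth q_gt0 q_lt1 dot_norm e_basis action gd ga sc).
Qed.
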